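(* Let $0<s\le1/2$. Let $A_1,\dots,A_m$ be invertible $n\times n$ matrices such that $A_k-A_{k'}$ is invertible for $k\ne k'$, $1\le k,k'\le m$, let $\alpha_i>0$ for all $i$ with $\alpha_1+\cdots+\alpha_m=n$, and let $$Tf(x)=\int_{\mathbb{R}^n}|x-A_1y|^{-\alpha_1}\cdots|x-A_my|^{-\alpha_m}f(y)\,dy.$$ Then, with a constant $c$ independent of $f$ and $Q_0$, for any cube $Q_0\subset\mathbb{R}^n$ and $x\in Q_0$, $$M^{\sharp}_{0,s,Q_0}(Tf)(x)\le c\sum_{i=1}^m\ \sup_{x\in Q,\,Q\subset Q_0}\ \inf_{y\in Q}Mf(A_i^{-1}y).$$
   Context: All cubes have sides parallel to the axes. $Mf$ is the Hardy-Littlewood maximal function of $f$, and $Mf(A_i^{-1}y)$ means $(Mf)(A_i^{-1}y)$. The local sharp maximal function restricted to $Q_0$ is $$M^{\sharp}_{0,s,Q_0}g(x)=\sup_{x\in Q,\,Q\subset Q_0}\ \inf_c\ \inf\{\alpha\ge0:|\{y\in Q:|g(y)-c|>\alpha\}|<s|Q|\}\quad(x\in Q_0),$$ with supremum over cubes $Q$. *)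

(* Defs.v *)
From HB Require Import structures.
From mathcomp Require Import all_boot all_order all_algebra.
From mathcomp Require Import all_classical all_reals all_analysis.

Set Implicit Arguments.
Unset Strict Implicit.
Unset Printing Implicit Defensive.
Import Order.TTheory GRing.Theory Num.Theory.
Import numFieldNormedType.Exports.

Local Open Scope classical_set_scope.
Local Open Scope ring_scope.

(* The Borel sigma-algebra of R^n = 'cV[R]_n, as the product sigma-algebra
   generated by the coordinates. *)
Section measurable_cV.
Context {R : realType} (n : nat).

Let coord (i : 'I_n) (x : 'cV[R]_n) : measurableTypeR R := x i ord0.

Let cV_set0 : g_sigma_preimage coord set0.
Proof. exact: sigma_algebra0. Qed.

Let cV_setC A : g_sigma_preimage coord A -> g_sigma_preimage coord (~` A).
Proof. exact: sigma_algebraC. Qed.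

Let cV_bigcup (F : (set 'cV[R]_n)^nat) :
  (forall i, g_sigma_preimage coord (F i)) ->
  g_sigma_preimage coord (\bigcup_i (F i)).
Proof. exact: sigma_algebra_bigcup. Qed.

HB.instance Definition _ := @isMeasurable.Build default_measure_display
  'cV[R]_n (g_sigma_preimage coord) cV_set0 cV_setC cV_bigcup.

Lemma measurable_cV_coord (i : 'I_n) :
  measurable_fun [set: 'cV[R]_n]
    (fun x : 'cV[R]_n => x i ord0 : measurableTypeR R).
Proof.
move=> _ Y mY; rewrite setTI; apply: sub_sigma_algebra => /=.
rewrite -bigcup_seq/=; exists i => /=; first by rewrite mem_index_enum.
by exists Y => //; rewrite setTI.
Qed.

Lemma measurable_fun_cV d (T : measurableType d) (f : T -> 'cV[R]_n) :
  (forall i, measurable_fun [set: T]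
    (fun t => f t i ord0 : measurableTypeR R)) ->
  measurable_fun [set: T] f.
Proof.
move=> mf.
have fS : preimage_set_system setT f (g_sigma_preimage coord) `<=` measurable.
  rewrite -g_sigma_preimageE.
  apply: smallest_sub; first exact: sigma_algebra_measurable.
  move=> A [B]; rewrite -bigcup_seq/= => -[i _ [C mC <-]] <-.
  by rewrite !setTI; have := mf i measurableT C mC; rewrite setTI.
by move=> _ A mA; apply: fS; exists A.
Qed.

End measurable_cV.

Section cons_measure.
Context {R : realType} (n : nat).

Definition cV_cons (p : measurableTypeR R * 'cV[R]_n) : 'cV[R]_n.+1 :=
  \col_i oapp (fun j => p.2 j ord0) p.1 (unlift ord0 i).

Definition cV_uncons (v : 'cV[R]_n.+1) : measurableTypeR R * 'cV[R]_n :=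
  (v ord0 ord0, \col_j v (lift ord0 j) ord0).

Lemma cV_consK : cancel cV_cons cV_uncons.
Proof.
move=> [a v]; rewrite /cV_uncons mxE unlift_none; congr pair.
by apply/colP => j; rewrite !mxE liftK.
Qed.

Lemma cV_unconsK : cancel cV_uncons cV_cons.
Proof.
move=> v; apply/colP => i; rewrite mxE.
by case: unliftP => [j|] ->//=; rewrite mxE.
Qed.

Lemma measurable_cV_cons : measurable_fun setT cV_cons.
Proof.
apply: measurable_fun_cV => i.
under eq_fun do rewrite mxE.
case: unliftP => [j|] _ /=; last exact: measurable_fst.
exact: measurableT_comp (measurable_cV_coord j) measurable_snd.
Qed.

Lemma measurable_cV_uncons : measurable_fun setT cV_uncons.
Proof.
apply/measurable_fun_pairP; split => /=; first exact: measurable_cV_coord.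
apply: measurable_fun_cV => i /=.
under eq_fun do rewrite mxE.
exact: measurable_cV_coord.
Qed.

Variable nu : {sigma_finite_measure set (measurableTypeR R) -> \bar R}.
Variable mu : {sigma_finite_measure set 'cV[R]_n -> \bar R}.

Definition cons_measure : set 'cV[R]_n.+1 -> \bar R :=
  pushforward (nu \x mu)%E cV_cons.

Let cons_measure0 : cons_measure set0 = 0%E.
Proof. by rewrite /cons_measure /pushforward preimage_set0 measure0. Qed.

Let cons_measure_ge0 A : (0 <= cons_measure A)%E.
Proof. exact: (measure_ge0 (nu \x mu)%E). Qed.

Let cons_measure_sigma_additive : semi_sigma_additive cons_measure.
Proof.
have mpre A : measurable A -> measurable (cV_cons @^-1` A).
  by move=> mA; rewrite -[X in measurable X]setTI; exact: measurable_cV_cons.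
move=> F mF tF mUF; rewrite /cons_measure /pushforward preimage_bigcup.
apply: measure_semi_sigma_additive.
- by move=> k; exact: mpre.
- apply/trivIsetP => /= i j _ _ ij; rewrite -preimage_setI.
  by move/trivIsetP : tF => /(_ _ _ _ _ ij) ->//; rewrite preimage_set0.
- by rewrite -preimage_bigcup; exact: mpre.
Qed.

HB.instance Definition _ := isMeasure.Build _ _ _ cons_measure
  cons_measure0 cons_measure_ge0 cons_measure_sigma_additive.

Let cons_measure_sigma_finite : sigma_finite setT cons_measure.
Proof.
have /sigma_finiteP[F [TF ndF Foo]] := sigma_finiteT nu.
have /sigma_finiteP[G [TG ndG Goo]] := sigma_finiteT mu.
exists (fun k => cV_uncons @^-1` (F k `*` G k)).
  rewrite -preimage_bigcup (_ : \bigcup_k (F k `*` G k) = setT)//.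
  rewrite -setXTT TF TG predeqE => -[x y]; split.
    by move=> [k _ []/= ? ?]; split; exists k.
  move=> [/= [k _ Fkx] [l _ Gly]]; exists (maxn k l) => //; split.
    by move: x Fkx; exact/subsetPset/ndF/leq_maxl.
  by move: y Gly; exact/subsetPset/ndG/leq_maxr.
move=> k; have [mFk Fkoo] := Foo k; have [mGk Gkoo] := Goo k; split.
  rewrite -[X in measurable X]setTI.
  by apply: measurable_cV_uncons => //; exact: measurableX.
rewrite /cons_measure /pushforward -comp_preimage.
rewrite (_ : _ \o _ = id) ?preimage_id; last by apply/funext/cV_consK.
by rewrite product_measure1E// lte_mul_pinfty// ge0_fin_numE.
Qed.

HB.instance Definition _ := Measure_isSigmaFinite.Build _ _ _ cons_measure
  cons_measure_sigma_finite.

End cons_measure.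

(* Lebesgue measure on the Borel sets of R^n: the n-fold product of the
   one-dimensional one, along R^(n+1) = R x R^n. *)
Fixpoint borel_lebesgue {R : realType} (n : nat) :
    {sigma_finite_measure set 'cV[R]_n -> \bar R} :=
  match n with
  | 0 => dirac (0 : 'cV[R]_0)
  | n'.+1 => cons_measure (@lebesgue_measure R) (borel_lebesgue n')
  end.

Section lebesgue_cV.
Context (R : realType) (n : nat).

(* R^n with the sigma-algebra of Lebesgue measurable sets. *)
Definition lebesgue_cV_type :=
  caratheodory_type ((@borel_lebesgue R n)^*)%mu.

HB.instance Definition _ := Measurable.on lebesgue_cV_type.

Definition lebesgue_cV : set lebesgue_cV_type -> \bar R :=
  @completed_measure_extension _ _ _ (@borel_lebesgue R n).

HB.instance Definition _ := Measure.on lebesgue_cV.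

HB.instance Definition _ := Measure_isSigmaFinite.Build _ _ _ lebesgue_cV
  (completed_measure_extension_sigma_finite (sigma_finiteT _)).

End lebesgue_cV.
Arguments lebesgue_cV : clear implicits.

Definition cube {R : realType} {n : nat} (a : 'cV[R]_n) (l : R) :
    set (lebesgue_cV_type R n) :=
  [set y : 'cV[R]_n | forall i, a i ord0 <= y i ord0 <= a i ord0 + l].

Lemma measurable_cube (R : realType) n (a : 'cV[R]_n) (l : R) :
  measurable (cube a l : set 'cV[R]_n).
Proof.
rewrite (_ : cube a l = \bigcap_(i in [set: 'I_n])
    ((fun x : 'cV[R]_n => x i ord0 : measurableTypeR R) @^-1`
      `[a i ord0, a i ord0 + l])).
  apply: fin_bigcap_measurable => [|i _]; first exact: finite_finset.
  by rewrite -[X in measurable X]setTI; apply: measurable_cV_coord.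
apply/seteqP; split => y /= H i; first by move=> _; rewrite /= in_itv/=; exact: H.
by have := H i I; rewrite /= in_itv.
Qed.

Lemma borel_lebesgue_cube (R : realType) n (a : 'cV[R]_n) (l : R) : 0 < l ->
  borel_lebesgue n (cube a l) = (l ^+ n)%:E.
Proof.
move=> l0; elim: n a => [|n IH] a.
  rewrite /= /dirac indicE mem_set//; by case.
rewrite /= /cons_measure /pushforward.
rewrite (_ : _ @^-1` _ = `[a ord0 ord0, a ord0 ord0 + l] `*`
    cube (\col_j a (lift ord0 j) ord0) l).
  rewrite product_measure1E//; last exact: measurable_cube.
  rewrite [X in (_ * X)%E]IH.
  rewrite [X in (X * _)%E]lebesgue_measure_itv/= lte_fin ltrDl l0.
  by rewrite -EFinB -EFinM addrAC subrr add0r exprS.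
apply/seteqP; split => -[b v] /=.
  move=> H; split; first by have := H ord0; rewrite mxE unlift_none/= in_itv.
  by move=> j; have := H (lift ord0 j); rewrite !mxE liftK.
move=> [] /=; rewrite in_itv/= => H1 H2 i; rewrite mxE.
by case: unliftP => [j|] ->//=; have := H2 j; rewrite mxE.
Qed.

Lemma lebesgue_cV_cube (R : realType) n (a : 'cV[R]_n) (l : R) : 0 < l ->
  lebesgue_cV R n (cube a l) = (l ^+ n)%:E.
Proof.
move=> l0; rewrite /lebesgue_cV /completed_measure_extension.
rewrite measurable_mu_extE; first exact: borel_lebesgue_cube.
exact: measurable_cube.
Qed.

Section main_definitions.
Context {R : realType} {n : nat}.
Local Notation Rn := (lebesgue_cV_type R n).
Local Notation leb := (lebesgue_cV R n).
Implicit Types (Q : set Rn) (f g : Rn -> R) (x y : Rn).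

Definition enorm (x : 'cV[R]_n) : R := Num.sqrt (\sum_(i < n) x i ord0 ^+ 2).

Definition is_cube Q : Prop :=
  exists (a : 'cV[R]_n) (l : R), 0 < l /\ Q = cube a l.

(* The supremum is over all cubes containing x (uncentered maximal function). *)
Definition HL_max f x : \bar R :=
  ereal_sup [set (((fine (leb Q))^-1)%:E * \int[leb]_(y in Q) `|f y|%:E)%E
            | Q in [set Q | is_cube Q /\ Q x]].

Definition subcubes_at (Q0 : set Rn) x : set (set Rn) :=
  [set Q | [/\ is_cube Q, Q x & Q `<=` Q0]].

Definition local_sharp_max (s : R) (Q0 : set Rn) g x : \bar R :=
  ereal_sup [set
    ereal_inf [set
      ereal_inf [set a%:E | a in [set a : R | 0 <= a /\
        (leb (Q `&` [set y | (a < `|g y - c|)%R]) < s%:E * leb Q)%E]]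
    | c in [set: R]]
  | Q in subcubes_at Q0 x].

(* powR gives 0 `^ (- a) = 0 for a > 0, so the kernel takes a junk value where
   x = A i *m y; for invertible A i and n > 0 this is a null set of y. *)
Definition frac_kernel m (A : 'I_m -> 'M[R]_n) (alpha : 'I_m -> R)
    (x y : 'cV[R]_n) : R :=
  \prod_(i < m) enorm (x - A i *m y) `^ (- alpha i).

Definition frac_int m (A : 'I_m -> 'M[R]_n) (alpha : 'I_m -> R) f x : R :=
  \int[leb]_(y in setT) (frac_kernel A alpha x y * f y).

End main_definitions.

(* Main.v *)
Require Import Defs.
From mathcomp Require Import all_boot all_order all_algebra.
From mathcomp Require Import all_classical all_reals all_analysis.
From mathcomp Require Import measurable_realfun.
From mathcomp Require Import ring lra.
Import Order.TTheory GRing.Theory Num.Theory.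
Import numFieldNormedType.Exports.

(** Fix a cube [Q] with lower corner [a] and side [l] inside [Q0], and put [d = n l].
    Call [y] far when [|a - A_i y| >= 2 d] for all [i], and near otherwise. On [Q] the
    function [Tf] is compared with the constant [c], the integral of [K(a, y) f(y)]
    over the far [y], where [K] is the kernel of [T]. The theorem follows once
    [|Tf - c|] is at most a multiple of the sum of the infima of [Mf(A_i^-1 .)] over
    [Q], outside a set of measure less than [s |Q|].

    Far part. As the exponents add up to [n], the kernel is homogeneous of degree [-n]
    in the distances [u_i = |a - A_i y|]. Moving [a] to a point [x] of [Q] changes each
    distance by at most [d], so [|K(x, y) - K(a, y)|] is at most a multiple of the sum
    of the [d u_i^(-n-1)] ([frac_kernel_far_lipschitz]). Each term is summed over dyadic
    shells ([integral_tail_le]); the mass of [|f|] on a shell of radius [r] is at most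
    a multiple of [r^n] times the infimum of [Mf(A_i^-1 .)] over [Q]
    ([integral_ball_le_inf_HL_max]).

    Near part. The near part of [|f|] has mass at most a multiple of [l^n] times the
    sum of the infima. Since [A_k - A_k'] is invertible, [x] is close, relative to [|y|], to at most
    one of the points [A_k y]. Hence [K(x, y)] is at most a multiple of [|x|^-n] plus
    kernels with a single singularity ([frac_kernel_le_single]). The term [|x|^-n] is
    harmless outside a ball around 0 whose measure is a small fraction of [|Q|]. If all exponents
    are smaller than [n], the integral in [x] of a single-singularity kernel is bounded
    uniformly in [y], so by Tonelli it acts boundedly on integrable functions
    ([integral_single_kernel_operator_le]), and Chebyshev's inequality gives the
    exceptional set. [frac_int_oscillation_lt] puts the two parts together.

    Critical case. An exponent can reach [n] only when [m = 1], and then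
    [K(x, y) = |x - A y|^-n]. Almost everywhere convergence of [Tf] now forces [f = 0]
    almost everywhere ([ae_eq0_of_critical_integrable]): the truncation of the kernel to
    [N] dyadic scales has integral comparable with [N], but its integral against [|f|]
    stays bounded as [N] grows, at almost every point. *)

Local Open Scope classical_set_scope.
Local Open Scope ring_scope.

(** * The Euclidean norm *)

Section EuclideanNorm.
Context {R : realType} {n : nat}.
Implicit Types u v w : 'cV[R]_n.

Lemma enorm_ge0 u : 0 <= enorm u.
Proof. exact: sqrtr_ge0. Qed.

Lemma sqr_enorm u : enorm u ^+ 2 = \sum_i u i ord0 ^+ 2.
Proof. by rewrite sqr_sqrtr// sumr_ge0// => i _; exact: sqr_ge0. Qed.

Lemma normr_coord_le_enorm u i : `|u i ord0| <= enorm u.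
Proof.
rewrite -sqrtr_sqr ler_wsqrtr// (bigD1 i)//= lerDl sumr_ge0// => j _.
exact: sqr_ge0.
Qed.

Lemma enorm_eq0 u : enorm u = 0 -> u = 0.
Proof.
move=> u0; apply/colP => i; rewrite mxE; apply/eqP.
by rewrite -normr_le0 -u0; exact: normr_coord_le_enorm.
Qed.

Lemma enorm0 : enorm (0 : 'cV[R]_n) = 0.
Proof. by rewrite /enorm big1 ?sqrtr0// => i _; rewrite mxE expr0n. Qed.

Lemma enormN u : enorm (- u) = enorm u.
Proof. by congr Num.sqrt; apply: eq_bigr => i _; rewrite mxE sqrrN. Qed.

Lemma enorm_distC u v : enorm (u - v) = enorm (v - u).
Proof. by rewrite -enormN opprB. Qed.

Lemma enorm_gt0 u : u != 0 -> 0 < enorm u.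
Proof.
move=> u0; rewrite lt_neqAle enorm_ge0 andbT eq_sym.
by apply: contra u0 => /eqP /enorm_eq0 ->.
Qed.

Lemma dotp_le_enorm u v : \sum_i u i ord0 * v i ord0 <= enorm u * enorm v.
Proof.
have [u0|u0] := eqVneq u 0.
  by rewrite u0 enorm0 mul0r big1// => i _; rewrite mxE mul0r.
have [v0|v0] := eqVneq v 0.
  by rewrite v0 enorm0 mulr0 big1// => i _; rewrite mxE mulr0.
set a := enorm u; set b := enorm v; set d := \sum_i _.
have a0 : 0 < a by exact: enorm_gt0.
have b0 : 0 < b by exact: enorm_gt0.
have : 0 <= \sum_i (b * u i ord0 - a * v i ord0) ^+ 2.
  by apply: sumr_ge0 => i _; exact: sqr_ge0.
rewrite (eq_bigr (fun i => b ^+ 2 * u i ord0 ^+ 2 +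
    (- (2 * a * b)) * (u i ord0 * v i ord0) + a ^+ 2 * v i ord0 ^+ 2)); last first.
  by move=> i _; ring.
rewrite !big_split/= -!mulr_sumr -!sqr_enorm -/a -/b -/d.
have ab0 : 0 < a * b by exact: mulr_gt0.
by move=> h; rewrite -(ler_pM2l ab0); lra.
Qed.

Lemma enormD u v : enorm (u + v) <= enorm u + enorm v.
Proof.
rewrite -(@ler_pXn2r _ 2)// ?nnegrE ?addr_ge0 ?enorm_ge0//.
rewrite sqrrD !sqr_enorm.
have -> : \sum_i (u + v) i ord0 ^+ 2 =
    \sum_i u i ord0 ^+ 2 + (\sum_i u i ord0 * v i ord0) *+ 2
    + \sum_i v i ord0 ^+ 2.
  rewrite -sumrMnl -!big_split/=; apply: eq_bigr => i _; rewrite mxE; ring.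
by rewrite lerD2r lerD2l lerMn2r/= dotp_le_enorm.
Qed.

Lemma enorm_dist_triangle u v w : enorm (u - w) <= enorm (u - v) + enorm (v - w).
Proof. by rewrite -{1}(subrK v u) -addrA; exact: enormD. Qed.

Lemma enorm_le_sum u : enorm u <= \sum_i `|u i ord0|.
Proof.
have S0 : 0 <= \sum_i `|u i ord0| by exact: sumr_ge0.
rewrite -(@ler_pXn2r _ 2)// ?nnegrE ?enorm_ge0// sqr_enorm [leRHS]expr2 mulr_suml.
apply: ler_sum => i _; rewrite -real_normK ?num_real// expr2.
by rewrite ler_wpM2l// (bigD1 i)//= lerDl sumr_ge0.
Qed.

End EuclideanNorm.

Section OperatorBound.
Context {R : realType} {n : nat}.

Lemma enorm_mulmx_le (A : 'M[R]_n) (v : 'cV[R]_n) :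
  enorm (A *m v) <= (\sum_i \sum_j `|A i j|) * enorm v.
Proof.
apply: le_trans (enorm_le_sum _) _; rewrite mulr_suml; apply: ler_sum => i _.
rewrite mxE mulr_suml; apply: le_trans (ler_norm_sum _ _ _) _.
apply: ler_sum => j _; rewrite normrM ler_wpM2l//.
exact: normr_coord_le_enorm.
Qed.

(** One constant serves the matrices of the kernel, their inverses and the inverses of
    their differences, each a finite family. *)
Lemma enorm_mulmx_uniform (I : finType) (A : I -> 'M[R]_n) :
  exists C : R, 1 <= C /\ forall i v, enorm (A i *m v) <= C * enorm v.
Proof.
pose o i : R := \sum_j \sum_k `|A i j k|.
have o0 i : 0 <= o i by apply: sumr_ge0 => j _; exact: sumr_ge0.
exists (1 + \sum_i o i); split; first by rewrite lerDl sumr_ge0.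
move=> i v; apply: le_trans (enorm_mulmx_le _ _) _.
rewrite ler_wpM2r ?enorm_ge0// (bigD1 i)//= -/(o i).
by rewrite addrCA lerDl addr_ge0// sumr_ge0.
Qed.

End OperatorBound.

(** * Products of powers whose exponents add up to n *)

Section PowR.
Context {R : realType}.

Lemma powR_prod (I : finType) (P : pred I) (x : R) (a : I -> R) : 0 < x ->
  \prod_(i | P i) x `^ a i = x `^ (\sum_(i | P i) a i).
Proof.
move=> x0; elim/big_ind2 : _ => [|r u t v -> ->|//]; first by rewrite powRr0.
by rewrite powRD// (gt_eqF x0)/= implybT.
Qed.

Lemma le_powRN (x y a : R) : 0 < x -> 0 <= a -> x <= y -> y `^ (- a) <= x `^ (- a).
Proof.
move=> x0 a0 xy; have y0 := lt_le_trans x0 xy.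
rewrite !powRN lef_pV2 ?posrE ?powR_gt0//.
by apply: ge0_ler_powR => //; rewrite nnegrE ltW.
Qed.

Lemma prod_powRN (m k : nat) (x : R) (a : 'I_m -> R) : 0 < x ->
  \sum_(i < m) a i = k%:R -> \prod_(i < m) x `^ (- a i) = x ^- k.
Proof. by move=> x0 ak; rewrite powR_prod// sumrN ak powR_invn// ltW. Qed.

End PowR.

Section KernelAlgebra.
Context {R : realType} {m n : nat} (alpha : 'I_m -> R).
Hypothesis alpha_ge0 : forall i, 0 <= alpha i.
Hypothesis alpha_sum : \sum_(i < m) alpha i = n%:R.
Implicit Types u v : 'I_m -> R.

Let P u := \prod_(i < m) u i `^ (- alpha i).

Lemma prod_powRN_ge0 u : 0 <= P u.
Proof. by apply: prodr_ge0 => i _; exact: powR_ge0. Qed.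

Lemma prod_powRN_le u (r : R) : 0 < r -> (forall i, r <= u i) -> P u <= r ^- n.
Proof.
move=> r0 ru; rewrite -(prod_powRN _ _ _ _ r0 alpha_sum); apply: ler_prod => i _.
by rewrite powR_ge0/= le_powRN.
Qed.

(** The exponents add up to [n], so rescaling all arguments by the same factor [r]
    multiplies the product by exactly [r ^- n]; the rest is monotonicity. *)
Lemma prod_powRN_scale u v (r : R) : 0 < r -> (forall i, 0 < u i) ->
  (forall i, r * u i <= v i) -> P v <= r ^- n * P u.
Proof.
move=> r0 u0 uv; rewrite -(prod_powRN _ _ _ _ r0 alpha_sum) -big_split/=.
apply: ler_prod => i _; rewrite powR_ge0/= -powRM; [|exact: ltW..].
by rewrite le_powRN// mulr_gt0.
Qed.

Lemma bernoulli_expr (t : R) (k : nat) : 0 <= t <= 1 -> 1 - k%:R * t <= (1 - t) ^+ k.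
Proof.
move=> /andP[t0 t1]; elim: k => [|k IH]; first by rewrite mul0r subr0 expr0.
rewrite exprS; apply: (@le_trans _ _ ((1 - t) * (1 - k%:R * t))); last first.
  by rewrite ler_wpM2l// subr_ge0.
have k0 : 0 <= k%:R :> R by [].
rewrite -natr1; nra.
Qed.

(** A relative perturbation of size [t] multiplies the product by a factor between
    [(1 + t) ^- n] and [(1 - t) ^- n], by homogeneity. The first is at least
    [(1 - t) ^+ n], so Bernoulli's inequality bounds both deviations from 1 by
    [n t], up to the factor [(1 - t) ^- n <= 2 ^+ n]. *)
Lemma prod_powRN_lipschitz u v (t : R) : 0 <= t <= 2^-1 -> (forall i, 0 < u i) ->
  (forall i, (1 - t) * u i <= v i <= (1 + t) * u i) ->
  `|P v - P u| <= 2 ^+ n * n%:R * t * P u.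
Proof.
move=> /andP[t0 t2] u0 uv; have t1 : t <= 1 by lra.
have v0 i : 0 < v i.
  by apply: lt_le_trans (andP (uv i)).1; rewrite mulr_gt0//; lra.
have q0 : 0 < 1 - t by lra.
have qq : (1 - t) ^+ n * (1 + t) ^+ n <= 1.
  by rewrite -exprMn exprn_ile1//; [rewrite mulr_ge0//; lra | nra].
have qb := bernoulli_expr t n (introT andP (conj t0 t1)).
have q2 : 1 <= 2 ^+ n * (1 - t) ^+ n by rewrite -exprMn exprn_ege1//; lra.
have up := prod_powRN_scale u v (1 - t) q0 u0 (fun i => (andP (uv i)).1).
have dn : P u <= (1 + t) ^+ n * P v.
  rewrite -[(1 + t) ^+ n]invrK -exprVn; apply: prod_powRN_scale => //.
    by rewrite invr_gt0; lra.
  by move=> i; rewrite ler_pdivrMl ?(andP (uv i)).2//; lra.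
have Pu0 := prod_powRN_ge0 u; have Pv0 := prod_powRN_ge0 v.
move: qb q2 up dn qq; have : 0 < (1 - t) ^+ n by exact: exprn_gt0.
have : 1 <= 2 ^+ n :> R by rewrite exprn_ege1// ler1n.
have : 0 <= n%:R * t by rewrite mulr_ge0.
rewrite -(mulrA (2 ^+ n)); move: ((1 - t) ^+ n) ((1 + t) ^+ n) (2 ^+ n) (n%:R * t)
  (P u) (P v) Pu0 Pv0.
move=> q q' e a x y x0 y0 a0 e1 q'0 qa eq up dn qq.
have {}up : q * y <= x by rewrite -ler_pdivlMl.
have lo : q * x <= y.
  by apply: (le_trans (ler_wpM2l (ltW q'0) dn)); rewrite mulrA ler_piMl.
have ax : a * x <= e * (a * x) by rewrite ler_peMl// mulr_ge0.
have qx : (1 - a) * x <= q * x by rewrite ler_wpM2r.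
rewrite -mulrA ler_norml; apply/andP; split.
  by move: ax lo qx; lra.
have [yx|xy] := leP y x.
  by apply: (@le_trans _ _ 0); rewrite ?subr_le0// !mulr_ge0// (le_trans ler01).
have : y - x <= e * (q * (y - x)) by rewrite mulrA ler_peMl// subr_ge0 ltW.
have : e * (q * (y - x)) <= e * (a * x).
  rewrite ler_wpM2l ?(le_trans ler01)//.
  by move: up qx; lra.
by lra.
Qed.

End KernelAlgebra.

(** * Pointwise bounds on the fractional kernel *)

Section KernelBounds.
Context {R : realType} {m n : nat} (A : 'I_m -> 'M[R]_n) (alpha : 'I_m -> R).
Hypothesis alpha_ge0 : forall i, 0 <= alpha i.
Hypothesis alpha_sum : \sum_(i < m) alpha i = n%:R.
Implicit Types x y z : 'cV[R]_n.
Local Notation K := (frac_kernel A alpha).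

Lemma frac_kernel_ge0 x y : 0 <= K x y.
Proof. exact: prod_powRN_ge0. Qed.

Section Far.
Variables (d : R) (x z y : 'cV[R]_n).
Hypotheses (d_gt0 : 0 < d) (xz : enorm (x - z) <= d).
Hypothesis far : forall j, 2 * d <= enorm (z - A j *m y).

Let u_gt0 j : 0 < enorm (z - A j *m y).
Proof. by apply: lt_le_trans (far j); rewrite mulr_gt0. Qed.

Let u_le j : enorm (z - A j *m y) - d <= enorm (x - A j *m y).
Proof.
rewrite lerBlDl; apply: le_trans (enorm_dist_triangle z x (A j *m y)) _.
by rewrite enorm_distC lerD2r.
Qed.

Let u_ge j : enorm (x - A j *m y) <= enorm (z - A j *m y) + d.
Proof.
by apply: le_trans (enorm_dist_triangle x z (A j *m y)) _; rewrite addrC lerD2l.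
Qed.

(** This transfers integrability over the far region from a good point [x] of the
    cube to the corner [z], where the full integral may diverge. *)
Lemma frac_kernel_far_comparable : K z y <= 2 ^+ n * K x y.
Proof.
rewrite -[2 ^+ n]invrK -exprVn; apply: prod_powRN_scale => //.
- by move=> j; have := u_le j; have := far j; move: d_gt0; lra.
- by move=> j; rewrite ler_pdivrMl//; have := u_ge j; have := far j; move: d_gt0; lra.
Qed.

(** With [i0] the index of the smallest distance, all the distances change by a
    relative amount of at most [t = d / u i0], and the kernel at [z] is at most
    [u i0 ^- n]. Bounding [u i0 ^- n.+1] by the sum over all indices removes the
    dependence of [i0] on [y]. *)
Lemma frac_kernel_far_lipschitz (n_gt0 : (0 < n)%N) :
  `|K x y - K z y| <=
  2 ^+ n * n%:R * d * \sum_(i < m) enorm (z - A i *m y) ^- n.+1.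
Proof.
have m_gt0 : (0 < m)%N.
  case: (posnP m) => // m0; move: alpha_sum; rewrite big1; last first.
    by move=> [i im]; exfalso; rewrite m0 in im.
  by move=> /eqP; rewrite eq_sym pnatr_eq0 => /eqP n0; rewrite n0 in n_gt0.
pose u j := enorm (z - A j *m y).
have [i0 _ u_min] : exists2 i0, xpredT i0 & forall j, u i0 <= u j.
  case: (@Order.TotalTheory.arg_minP _ _ _ (Ordinal m_gt0) xpredT u) => // i _ h.
  by exists i => // j; exact: h.
have t_le j : d <= d / u i0 * u j
  by rewrite -mulrA ler_peMr ?(ltW d_gt0)// ler_pdivlMl ?mulr1 ?u_min//; exact: u_gt0.
have t_bd : 0 <= d / u i0 <= 2^-1.
  rewrite divr_ge0 ?enorm_ge0 ?(ltW d_gt0)//= ler_pdivrMr ?u_gt0//.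
  by have := far i0; rewrite -/(u i0); move: d_gt0; lra.
apply: (le_trans (prod_powRN_lipschitz alpha alpha_ge0 alpha_sum _ _ _ t_bd u_gt0 _)).
  move=> j; rewrite mulrBl mulrDl mul1r; have := t_le j; have := u_le j.
  by have := u_ge j; rewrite -/(u j) => ? ? ?; apply/andP; split; lra.
rewrite -(mulrA _ (d / _)) -(mulrA _ d) ler_wpM2l ?mulr_ge0 ?exprn_ge0//.
rewrite -mulrA ler_wpM2l ?(ltW d_gt0)//.
apply: (@le_trans _ _ (u i0 ^- n.+1)); last first.
  by rewrite (bigD1 i0)//= lerDl sumr_ge0// => j _; rewrite invr_ge0 exprn_ge0// enorm_ge0.
rewrite exprS invfM ler_wpM2l ?invr_ge0 ?enorm_ge0//.
by apply: prod_powRN_le => //; exact: u_gt0.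
Qed.

End Far.

Section Near.
Variable C : R.
Hypothesis C_ge1 : 1 <= C.
Hypothesis A_le : forall i v, enorm (A i *m v) <= C * enorm v.
Hypothesis AB_ge : forall k k', k != k' -> forall v,
  enorm v <= C * enorm ((A k - A k') *m v).

(** The part of the fractional kernel where [A k *m y] is so close to [x] that the
    other factors are comparable with a power of [enorm y]. *)
Definition single_kernel k x y : R :=
  let r := enorm y / (2 * C) in
  let u := enorm (x - A k *m y) in
  if u < r then r `^ (- (n%:R - alpha k)) * u `^ (- alpha k) else 0.

Lemma single_kernel_ge0 k x y : 0 <= single_kernel k x y.
Proof. by rewrite /single_kernel; case: ifP => // _; rewrite mulr_ge0// powR_ge0. Qed.

(** Either all the distances [enorm (x - A k *m y)] are at least
    [r = enorm y / (2 C)], and then each of them dominates a multiple of [enorm x];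
    or one of them, say the [k]-th, is smaller than [r]. In the latter case
    [enorm ((A j - A k) *m y) >= 2 r] forces every other distance to be at least [r]. *)
Lemma frac_kernel_le_single x y : x != 0 ->
  K x y <= (1 + 2 * C ^+ 2) ^+ n * enorm x ^- n + \sum_(k < m) single_kernel k x y.
Proof.
move=> x0; set r := enorm y / (2 * C); have C0 : 0 < C by exact: lt_le_trans C_ge1.
have yr : enorm y = 2 * C * r by rewrite /r mulrC divfK// gt_eqF// mulr_gt0.
have [[k uk]|] := pselect (exists k, enorm (x - A k *m y) < r); last first.
  move=> /forallNP hr.
  have {}hr k : r <= enorm (x - A k *m y) by rewrite leNgt; apply/negP/hr.
  rewrite (@le_trans _ _ ((1 + 2 * C ^+ 2) ^+ n * enorm x ^- n))//; last first.
    by rewrite lerDl sumr_ge0// => k _; exact: single_kernel_ge0.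
  have c0 : 0 < 1 + 2 * C ^+ 2 by nra.
  rewrite -[_ ^+ n * _]invrK invfM invrK -exprVn -exprMn.
  apply: prod_powRN_le => //.
    by rewrite mulr_gt0 ?invr_gt0// enorm_gt0.
  move=> k; rewrite ler_pdivrMl// -[in leLHS](subrK (A k *m y) x).
  apply: (le_trans (enormD _ _)).
  have := A_le k y; have := hr k; rewrite yr; nra.
rewrite (bigD1 k)//= {1}/single_kernel -/r uk.
have r0 : 0 < r by exact: le_lt_trans (enorm_ge0 _) uk.
have other j : j != k -> r <= enorm (x - A j *m y).
  move=> jk; have := AB_ge _ _ jk y.
  have -> : (A j - A k) *m y = (x - A k *m y) - (x - A j *m y).
    by rewrite mulmxBl opprB [RHS]addrC addrA subrK.
  move=> h; have := enormD (x - A k *m y) (- (x - A j *m y)).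
  rewrite enormN => h2; have {h2}h := le_trans h (ler_wpM2l (ltW C0) h2).
  move: h; rewrite yr (mulrC 2) -mulrA ler_pM2l//; lra.
rewrite addrCA ler_wpDr ?addr_ge0 ?mulr_ge0 ?sumr_ge0 ?invr_ge0 ?exprn_ge0 ?enorm_ge0//.
- by nra.
- by move=> j _; exact: single_kernel_ge0.
rewrite /frac_kernel (bigD1 k)//= mulrC ler_wpM2r ?powR_ge0//.
have -> : - (n%:R - alpha k) = \sum_(j < m | j != k) (- alpha j).
  by rewrite -alpha_sum (bigD1 k)//= addrAC subrr add0r sumrN.
rewrite -powR_prod//; apply: ler_prod => j jk; rewrite powR_ge0/=.
by apply: le_powRN => //; exact: other.
Qed.

End Near.
End KernelBounds.

(** * Integration over dyadic scales *)

Section DyadicSums.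
Context {R : realType}.

Lemma dyadic_scale (r u : R) : 0 < r -> r <= u ->
  exists k, 2 ^+ k * r <= u < 2 ^+ k.+1 * r.
Proof.
move=> r0 ru.
have ex : exists k, u < 2 ^+ k.+1 * r.
  exists (Num.bound (u / r)); rewrite -ltr_pdivrMr//.
  exact: upper_nthrootP.
case: (ex_minnP ex) => k uk kmin; exists k; rewrite uk andbT.
case: k kmin {uk} => [|k] kmin; first by rewrite expr0 mul1r.
by rewrite leNgt; apply/negP => /kmin; rewrite ltnn.
Qed.

Lemma exprn_powR (x a : R) k : 0 <= x -> (x ^+ k) `^ a = (x `^ a) ^+ k.
Proof.
move=> x0; elim: k => [|k IH]; first by rewrite !expr0 powR1.
by rewrite !exprS powRM ?IH// exprn_ge0.
Qed.

Lemma nneseries_geometric_le (M q : R) : 0 <= M -> 0 < q < 1 ->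
  (\sum_(0 <= k <oo) (M * q ^+ k)%:E <= (M / (1 - q))%:E)%E.
Proof.
move=> M0 /andP[q0 q1]; apply: lime_le.
  by apply: is_cvg_nneseries => k _ _; rewrite lee_fin mulr_ge0// exprn_ge0// ltW.
apply: nearW => N; rewrite sumEFin lee_fin.
by apply: (@geometric_le_lim R N M q) => //; rewrite ger0_norm// ltW.
Qed.

Context {d} {T : measurableType d} (mu : {measure set T -> \bar R}).
Variables (n : nat) (u h : T -> R) (g : T -> \bar R).
Hypotheses (mu_ : measurable_fun setT u) (mh : measurable_fun setT h).
Hypotheses (mg : measurable_fun setT g) (g0 : forall x, (0 <= g x)%E).
Hypothesis h0 : forall x, 0 <= h x.

Lemma measurable_sublevel (r : R) : measurable [set x | u x < r].
Proof.
have := measurable_fun_ltr mu_ (@measurable_cst _ _ T _ setT r).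
move=> /(_ measurableT [set true]); rewrite setTI; apply => //.
Qed.

(** All radial integrals below come from this one comparison: [h] is dominated by the
    sum of [c k] times the indicator of [u < r k], the mass of [g] on [u < r k] grows
    like [r k ^+ n], and the resulting series is geometric. *)
Lemma integral_dyadic_le (B M q : R) (c r : nat -> R) :
  0 <= B -> 0 <= M -> 0 < q < 1 -> (forall k, 0 <= c k) ->
  (forall k, \int[mu]_(x in [set x | (u x < r k)%R]) g x <= (B * r k ^+ n)%:E)%E ->
  (forall k, c k * r k ^+ n <= M * q ^+ k) ->
  (forall x, 0 < h x -> exists2 k, u x < r k & h x <= c k) ->
  (\int[mu]_x ((h x)%:E * g x) <= (B * M / (1 - q))%:E)%E.
Proof.
move=> B0 M0 q01 c0 gB cM hc.
pose S k := [set x | u x < r k].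
have mS k : measurable (S k) by exact: measurable_sublevel.
pose F k x := ((c k)%:E * (g \_ (S k)) x)%E.
have F0 k x : (0 <= F k x)%E.
  by rewrite mule_ge0 ?lee_fin//; apply: erestrict_ge0 => y _.
have mF k : measurable_fun setT (F k).
  apply: emeasurable_funM => //.
  by apply/(measurable_restrictT _ (mS k)); exact: measurable_funTS.
apply: (@le_trans _ _ (\int[mu]_x \sum_(0 <= k <oo) F k x)%E).
  apply: ge0_le_integral => //.
  - by move=> x _; rewrite mule_ge0 ?lee_fin.
  - by apply: emeasurable_funM => //; exact/measurable_EFinP.
  - by apply: ge0_emeasurable_sum => //.
  move=> x _; have [hx0|hx0] := leP (h x) 0.
    have -> : h x = 0 by apply/eqP; rewrite eq_le hx0 h0.
    by rewrite mul0e; exact: nneseries_ge0.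
  have [k uk hk] := hc _ hx0.
  apply: (@le_trans _ _ (F k x)).
    by rewrite /F patchE mem_set// lee_wpmul2r// lee_fin.
  apply: le_trans (@nneseries_lim_ge _ _ xpredT 0%N k.+1 _) => //.
  by rewrite big_nat_recr//= leeDr// sume_ge0.
rewrite integral_nneseries//.
apply: (@le_trans _ _ (\sum_(0 <= k <oo) (B * M * q ^+ k)%:E)%E); last first.
  by apply: nneseries_geometric_le => //; rewrite mulr_ge0.
apply: lee_nneseries => [k _ _|k _]; first exact: integral_ge0.
rewrite ge0_integralZl ?lee_fin//; first last.
- by move=> x _; apply: erestrict_ge0.
- by apply/(measurable_restrictT _ (mS k)); exact: measurable_funTS.
rewrite -integral_mkcond.
apply: (@le_trans _ _ ((c k)%:E * (B * r k ^+ n)%:E)%E).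
  apply: lee_wpmul2l; last exact: gB.
  by rewrite lee_fin.
by rewrite -EFinM lee_fin mulrCA -mulrA ler_wpM2l.
Qed.

End DyadicSums.

(** * Lebesgue measure of balls and local integrability of powers *)

Section Lebesgue.
Context {R : realType} {n : nat}.
Local Notation Rn := (lebesgue_cV_type R n).
Local Notation leb := (lebesgue_cV R n).

Lemma measurable_borel (X : set 'cV[R]_n) :
  measurable X -> measurable (X : set Rn).
Proof. by move=> mX; apply: sub_caratheodory; exact: sub_sigma_algebra. Qed.

Lemma measurable_coord (i : 'I_n) :
  measurable_fun [set: Rn] (fun x : Rn => x i ord0 : R).
Proof.
move=> _ Y mY; rewrite setTI; apply: measurable_borel.
by have := @measurable_cV_coord R n i measurableT Y mY; rewrite setTI.
Qed.

(** The measure extends to an outer measure on all sets. This lets the level sets in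
    the sharp maximal function be bounded through measurable sets that cover them. *)
Lemma le_lebesgue (X Y : set Rn) : X `<=` Y -> (leb X <= leb Y)%E.
Proof. exact: (le_outer_measure (borel_lebesgue n)^*%mu). Qed.

Lemma measurable_lebesgue_cube (a : 'cV[R]_n) l : measurable (cube a l).
Proof. by apply: measurable_borel; exact: measurable_cube. Qed.

Section Measurability.
Context {d} {T : measurableType d}.

Lemma measurable_enorm (F : T -> 'cV[R]_n) :
  (forall i, measurable_fun setT (fun t => F t i ord0)) ->
  measurable_fun setT (fun t => enorm (F t)).
Proof.
move=> mF.
have msqrt : measurable_fun [set: R] (@Num.sqrt R).
  by apply: continuous_measurable_fun; exact: sqrt_continuous.
apply: (measurableT_comp msqrt).
apply: measurable_sum => i; exact: measurable_funX.
Qed.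

Lemma measurable_enorm_affine (A : 'M[R]_n) (F G : T -> Rn) :
  measurable_fun setT F -> measurable_fun setT G ->
  measurable_fun setT (fun t => enorm (F t - A *m G t)).
Proof.
move=> mF mG; apply: measurable_enorm => i.
under eq_fun do rewrite !mxE.
apply: measurable_funB.
  exact: (measurableT_comp (measurable_coord i) mF).
apply: measurable_sum => j; apply: measurable_funM => //.
exact: (measurableT_comp (measurable_coord j) mG).
Qed.

End Measurability.

Lemma enorm_lt_sub_cube (p : 'cV[R]_n) r :
  [set x : Rn | enorm (x - p) < r] `<=` cube (p - const_mx r) (2 * r).
Proof.
move=> x /= xr i; have := normr_coord_le_enorm (x - p) i.
rewrite !mxE ler_norml => /andP[h1 h2]; apply/andP; split; lra.
Qed.

Lemma lebesgue_ball_le (p : 'cV[R]_n) r : 0 < r ->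
  (leb [set x : Rn | (enorm (x - p) < r)%R] <= ((2 * r) ^+ n)%:E)%E.
Proof.
move=> r0; apply: le_trans (le_lebesgue _ _ (enorm_lt_sub_cube p r)) _.
by rewrite lebesgue_cV_cube// mulr_gt0.
Qed.

Lemma preimage_ball_sub (A : 'M[R]_n) (C r : R) (z : 'cV[R]_n) :
  A \in unitmx -> 0 < C -> (forall v, enorm (invmx A *m v) <= C * enorm v) ->
  [set y : Rn | enorm (z - A *m y) < r] `<=`
  [set y : Rn | enorm (y - invmx A *m z) < C * r].
Proof.
move=> uA C0 hC y /= yr.
rewrite -[y in y - _](mulKmx uA) -mulmxBr (le_lt_trans (hC _))// ltr_pM2l//.
by rewrite enorm_distC.
Qed.

Lemma measurable_enorm_dist (p : 'cV[R]_n) :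
  measurable_fun [set: Rn] (fun x : Rn => enorm (x - p)).
Proof.
have := @measurable_enorm_affine _ Rn 1%:M id (cst p)
  (@measurable_id _ _ _) (@measurable_cst _ _ _ _ _ _).
by under eq_fun do rewrite mul1mx.
Qed.

(** The shells [enorm (x - p) ~ r / 2 ^+ k] contribute [r `^ (n - a)] times the
    powers of [2 `^ a / 2 ^+ n], a ratio smaller than 1 because [a < n]. *)
Lemma integral_enorm_powR_le (a : R) : 0 < a < n%:R ->
  exists2 C : R, 0 < C & forall (p : 'cV[R]_n) (r : R), 0 < r ->
    (\int[leb]_x (if (enorm (x - p) < r)%R
        then enorm (x - p) `^ (- a) else 0)%:E <=
      (C * (r `^ (- a) * r ^+ n))%:E)%E.
Proof.
move=> /andP[a0 an].
pose w : R := 2 `^ a; have w0 : 0 < w by exact: powR_gt0.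
have n2 : 0 < 2 ^+ n :> R by exact: exprn_gt0.
have wn : w < 2 ^+ n.
  by rewrite -powR_mulrn// /w /powR pnatr_eq0/= ltr_expR ltr_pM2r// ln_gt0// ltr1n.
have q01 : 0 < w / 2 ^+ n < 1 by rewrite divr_gt0//= ltr_pdivrMr// mul1r.
exists (2 ^+ n * (2 ^+ n * w) / (1 - w / 2 ^+ n)).
  by case/andP: q01 => _ q1; rewrite divr_gt0 ?mulr_gt0// subr_gt0.
move=> p r r0; have ra0 := powR_ge0 r (- a).
have mu_ := measurable_enorm_dist p.
under eq_integral do rewrite -[X in X%:E]mulr1 EFinM.
have -> : 2 ^+ n * (2 ^+ n * w) / (1 - w / 2 ^+ n) * (r `^ (- a) * r ^+ n) =
    2 ^+ n * (r `^ (- a) * (2 * r) ^+ n * w) / (1 - w / 2 ^+ n).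
  by rewrite exprMn; ring.
pose h (x : Rn) : R := if enorm (x - p) < r then enorm (x - p) `^ (- a) else 0.
have mh : measurable_fun setT h.
  apply: measurable_fun_ifT.
  - by apply: measurable_fun_ltr; [exact: mu_|exact: measurable_cst].
  - exact: (measurableT_comp (measurable_powR (- a)) mu_).
  - exact: measurable_cst.
have h_ge0 x : 0 <= h x by rewrite /h; case: ifP => // _; exact: powR_ge0.
have mg : measurable_fun [set: Rn] (cst (1%E : \bar R)) by exact: measurable_cst.
apply: (@integral_dyadic_le _ _ _ leb n _ h (cst 1%E) mu_ mh mg _ h_ge0 _ _ _
  (fun k => r `^ (- a) * w ^+ k.+1) (fun k => 2 * r / 2 ^+ k) _ _ q01).
- by [].
- exact: ltW.
- by rewrite !mulr_ge0// ?exprn_ge0 ?mulr_ge0 ?(ltW r0) ?(ltW w0).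
- by move=> k; rewrite mulr_ge0// exprn_ge0// ltW.
- move=> k; rewrite integral_cst ?mul1e; last exact: measurable_sublevel.
  rewrite -exprMn; apply: lebesgue_ball_le.
  by rewrite divr_gt0// ?mulr_gt0// exprn_gt0.
- move=> k; rewrite !exprMn !exprVn exprS -!exprM (mulnC n k) le_eqVlt; apply/orP; left.
  by apply/eqP; ring.
move=> x; rewrite /h; case: ifP; last by rewrite ltxx.
move=> xr h0; set u := enorm (x - p) in xr h0 *.
have u0 : 0 < u.
  rewrite lt_neqAle enorm_ge0 andbT; apply/eqP => u0.
  by move: h0; rewrite -u0 powR0 ?ltxx// oppr_eq0 gt_eqF.
have [k /andP[k1 k2]] := dyadic_scale _ _ u0 (ltW xr).
have k0 : 0 < 2 ^+ k :> R by exact: exprn_gt0.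
exists k.
  by rewrite ltr_pdivlMr// mulrC (le_lt_trans k1)// ltr_pMl// ltr1n.
have -> : r `^ (- a) * w ^+ k.+1 = (r / 2 ^+ k.+1) `^ (- a).
  rewrite powRM ?invr_ge0 ?exprn_ge0 ?(ltW r0)//; congr (_ * _).
  rewrite -exprVn exprn_powR ?invr_ge0//; congr (_ ^+ _).
  by rewrite -powR_inv1// -powRrM mulN1r opprK.
apply: le_powRN; rewrite ?divr_gt0 ?exprn_gt0 ?(ltW a0)//.
by rewrite ler_pdivrMr ?exprn_gt0// mulrC ltW.
Qed.

End Lebesgue.

(** * Tails, the maximal function and single-singularity kernels *)

Section Tail.
Context {R : realType} {d} {T : measurableType d} (mu : {measure set T -> \bar R}).

Lemma measurable_tail_weight (n : nat) (u : T -> R) (r0 : R) :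
  measurable_fun setT u -> 0 < r0 ->
  measurable_fun setT (fun x => if r0 <= u x then u x ^- n.+1 else 0).
Proof.
move=> mu_ r00.
rewrite (_ : (fun x => _) = fun x => if u x < r0 then 0 else u x `^ (- n.+1%:R)); last first.
  apply/funext => x; rewrite ltNge; case: (leP r0 (u x)) => //= rx.
  by rewrite powR_invn// (le_trans (ltW r00)).
apply: measurable_fun_ifT.
- by apply: measurable_fun_ltr; [exact: mu_|exact: measurable_cst].
- exact: measurable_cst.
- exact: (measurableT_comp (measurable_powR _) mu_).
Qed.

(** Same dyadic comparison as for the local singularity, now with shells that go to
    infinity: the decay [u ^- n.+1] beats the growth [r ^+ n] by one power of
    the radius. *)
Lemma integral_tail_le (n : nat) (u : T -> R) (g : T -> \bar R) (B r0 : R) :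
  measurable_fun setT u -> measurable_fun setT g -> (forall x, (0 <= g x)%E) ->
  0 <= B -> 0 < r0 ->
  (forall r, (r0 <= r)%R ->
    \int[mu]_(x in [set x | (u x < r)%R]) g x <= (B * r ^+ n)%:E)%E ->
  (\int[mu]_x ((if (r0 <= u x)%R then u x ^- n.+1 else 0)%:E * g x) <=
    (2 ^+ n.+1 * B / r0)%:E)%E.
Proof.
move=> mu_ mg g0 B0 r00 gB.
pose h x : R := if r0 <= u x then u x ^- n.+1 else 0.
have mh : measurable_fun setT h by exact: measurable_tail_weight.
have h_ge0 x : 0 <= h x.
  by rewrite /h; case: ifPn => // rx; rewrite invr_ge0 exprn_ge0// (le_trans (ltW r00)).
have q01 : 0 < (2^-1 : R) < 1 by lra.
have -> : 2 ^+ n.+1 * B / r0 = B * (2 ^+ n / r0) / (1 - 2^-1).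
  by rewrite exprS; field; rewrite gt_eqF.
have p0 k : 0 < 2 ^+ k :> R by exact: exprn_gt0.
apply: (@integral_dyadic_le _ _ _ mu n u h g mu_ mh mg g0 h_ge0 _ _ _
  (fun k => (2 ^+ k * r0) ^- n.+1) (fun k => 2 ^+ k.+1 * r0) _ _ q01).
- exact: B0.
- by rewrite divr_ge0 ?ltW.
- by move=> k; rewrite invr_ge0 exprn_ge0// mulr_ge0 ?ltW.
- by move=> k; apply: gB; rewrite ler_peMl ?(ltW r00)// exprn_ege1// ler1n.
- move=> k; rewrite le_eqVlt; apply/orP; left; apply/eqP.
  rewrite (exprS 2 k) -mulrA (exprMn _ 2) (exprS _ n) exprVn.
  have : (2 ^+ k * r0) ^+ n != 0 by rewrite expf_neq0// mulf_neq0// gt_eqF.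
  have : 2 ^+ k != 0 :> R by rewrite gt_eqF.
  move: (2 ^+ k) => w w0 e0; field.
  by rewrite w0 e0 gt_eqF.
move=> x; rewrite /h; case: ifP; last by rewrite ltxx.
move=> rx _; have [k /andP[k1 k2]] := dyadic_scale _ _ r00 rx.
exists k => //; have ux := lt_le_trans r00 rx.
rewrite lef_pV2 ?posrE ?exprn_gt0 ?mulr_gt0//.
by rewrite lerXn2r// ?nnegrE ?mulr_ge0 ?ltW.
Qed.

End Tail.


Section Maximal.
Context {R : realType} {n : nat}.
Local Notation Rn := (lebesgue_cV_type R n).
Local Notation leb := (lebesgue_cV R n).
Variable f : Rn -> R.
Hypothesis mf : measurable_fun setT f.

Lemma measurable_abs_fun : measurable_fun setT (fun y : Rn => `|f y|%:E).
Proof. by apply/measurable_EFinP; exact: measurableT_comp. Qed.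

Lemma integral_cube_le_HL_max (a : 'cV[R]_n) (l : R) (x : Rn) : 0 < l -> cube a l x ->
  (\int[leb]_(y in cube a l) `|f y|%:E <= (l ^+ n)%:E * HL_max f x)%E.
Proof.
move=> l0 ax; have ln0 : 0 < l ^+ n by exact: exprn_gt0.
rewrite -lee_pdivrMl//; apply: ereal_sup_ubound; exists (cube a l).
  by split => //; exists a, l.
by rewrite lebesgue_cV_cube.
Qed.

Lemma HL_max_ge0 x : (0 <= HL_max f x)%E.
Proof.
have h : cube (x : 'cV[R]_n) 1 x by move=> i; rewrite lexx/= lerDl.
have := integral_cube_le_HL_max _ _ _ ltr01 h; rewrite expr1n mul1e.
by apply: le_trans; apply: integral_ge0 => y _; rewrite lee_fin.
Qed.

(** The preimage of the ball around [z] lies in a cube of side [2 C r] that contains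
    [invmx A *m w] for every [w] in [Q], so the average of [f] over this cube competes
    in the definition of the maximal function at all these points simultaneously. *)
Lemma integral_ball_le_inf_HL_max (A : 'M[R]_n) (C r : R) (z : 'cV[R]_n) (Q : set Rn) :
  A \in unitmx -> 0 < C -> (forall v, enorm (invmx A *m v) <= C * enorm v) ->
  0 < r -> (forall w, Q w -> enorm (w - z) <= r) ->
  (\int[leb]_(y in [set y : Rn | (enorm (z - A *m y) < r)%R]) `|f y|%:E <=
    ((2 * (C * r)) ^+ n)%:E * ereal_inf [set HL_max f (invmx A *m w) | w in Q])%E.
Proof.
move=> uA C0 hC r0 Qr; have Cr : 0 < 2 * (C * r) by rewrite !mulr_gt0.
have Crn : 0 < (2 * (C * r)) ^+ n by exact: exprn_gt0.
rewrite -lee_pdivrMl//; apply: le_ereal_inf_tmp => _ [w Qw <-].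
rewrite lee_pdivrMl//.
pose p : 'cV[R]_n := invmx A *m z.
have wc : cube (p - const_mx (C * r)) (2 * (C * r)) (invmx A *m w).
  have wp : enorm (invmx A *m w - p) <= C * r.
    rewrite -mulmxBr (le_trans (hC _))// ler_wpM2l ?(ltW C0)//.
    exact: Qr.
  move=> i; have := le_trans (normr_coord_le_enorm _ i) wp.
  by rewrite ler_norml !mxE => /andP[h1 h2]; apply/andP; split; lra.
apply: le_trans (integral_cube_le_HL_max _ _ _ Cr wc).
apply: ge0_subset_integral.
- apply: measurable_sublevel; apply: measurable_enorm_affine.
    exact: measurable_cst.
  exact: measurable_id.
- exact: measurable_lebesgue_cube.
- by apply: measurable_funTS; exact: measurable_abs_fun.
- by move=> y _; rewrite lee_fin.
move=> y yr; apply: enorm_lt_sub_cube.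
exact: (preimage_ball_sub _ _ _ _ uA C0 hC _ yr).
Qed.

End Maximal.

Section SingleKernel.
Context {R : realType} {m n : nat} (A : 'I_m -> 'M[R]_n) (alpha : 'I_m -> R) (C : R).
Local Notation Rn := (lebesgue_cV_type R n).
Local Notation leb := (lebesgue_cV R n).
Hypothesis alpha_gt0 : forall k, 0 < alpha k.
Hypothesis alpha_lt : forall k, alpha k < n%:R.
Local Notation W := (single_kernel A alpha C).

Lemma measurable_single_kernel d (T : measurableType d) (F G : T -> Rn) k :
  measurable_fun setT F -> measurable_fun setT G ->
  measurable_fun setT (fun t => W k (F t) (G t)).
Proof.
move=> mF mG; rewrite /single_kernel/=.
have mu_ := measurable_enorm_affine (A k) F G mF mG.
have mr : measurable_fun setT (fun t => enorm (G t) / (2 * C)).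
  apply: measurable_funM; last exact: measurable_cst.
  by apply: measurable_enorm => i; exact: (measurableT_comp (measurable_coord i) mG).
apply: measurable_fun_ifT.
- by apply: measurable_fun_ltr.
- apply: measurable_funM.
  + exact: (measurableT_comp (measurable_powR _) mr).
  + exact: (measurableT_comp (measurable_powR _) mu_).
- exact: measurable_cst.
Qed.

(** The powers of [enorm y] cancel: the integral over the ball of radius [r] is of
    order [r `^ (n - alpha k)]. *)
Lemma integral_single_kernel_le k :
  exists2 c : R, 0 < c & forall y, (\int[leb]_x (W k x y)%:E <= c%:E)%E.
Proof.
have [c c0 hc] := integral_enorm_powR_le (alpha k) (introT andP (conj (alpha_gt0 k) (alpha_lt k))).
exists c => // y; rewrite /single_kernel/=; set r := _ / _.
have [r0|r0] := leP r 0.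
  rewrite integral0_eq ?lee_fin ?(ltW c0)// => x _.
  by rewrite ltNge (le_trans r0) ?enorm_ge0.
rewrite (_ : \int[leb]_x _ = (r `^ (- (n%:R - alpha k)))%:E * \int[leb]_x
  (if (enorm (x - A k *m y) < r)%R
    then enorm (x - A k *m y) `^ (- alpha k) else 0)%:E)%E; last first.
  rewrite -ge0_integralZl.
  - by apply: eq_integral => x _; case: ifP => _; rewrite -EFinM ?mulr0.
  - exact: measurableT.
  - apply/measurable_EFinP; apply: measurable_fun_ifT.
    + by apply: measurable_fun_ltr; [exact: measurable_enorm_dist|exact: measurable_cst].
    + exact: (measurableT_comp (measurable_powR _) (measurable_enorm_dist _)).
    + exact: measurable_cst.
  - by move=> x _; rewrite lee_fin; case: ifP => // _; exact: powR_ge0.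
  - by rewrite lee_fin powR_ge0.
apply: le_trans (lee_wpmul2l _ (hc _ _ r0)) _; first by rewrite lee_fin powR_ge0.
rewrite -EFinM lee_fin le_eqVlt; apply/orP; left; apply/eqP.
rewrite -powR_mulrn ?(ltW r0)// mulrCA -powRD ?(gt_eqF r0) ?implybT//.
rewrite -powRD ?(gt_eqF r0) ?implybT//
  (_ : - (n%:R - alpha k) + (- alpha k + n%:R) = 0) ?powRr0 ?mulr1//; ring.
Qed.

Lemma measurable_single_kernel_integrand (g : Rn -> \bar R) :
  measurable_fun setT g ->
  measurable_fun setT (fun p : Rn * Rn => ((\sum_(k < m) W k p.1 p.2)%:E * g p.2)%E).
Proof.
move=> mg; apply: emeasurable_funM; last exact: (measurableT_comp mg measurable_snd).
apply/measurable_EFinP; apply: measurable_sum => k.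
by apply: measurable_single_kernel; [exact: measurable_fst|exact: measurable_snd].
Qed.

(** Tonelli turns the uniform bound on the columns of the kernel into boundedness on
    the integrable functions; a strong estimate holds here although the full
    operator has only a weak one. *)
Lemma integral_single_kernel_operator_le :
  exists2 c : R, 0 < c & forall g : Rn -> \bar R, measurable_fun setT g ->
    (forall y, (0 <= g y)%E) ->
    (\int[leb]_x \int[leb]_y ((\sum_(k < m) W k x y)%R%:E * g y) <=
     c%:E * \int[leb]_y g y)%E.
Proof.
have /choice[c hc] k : exists c, 0 < c /\ forall y, (\int[leb]_x (W k x y)%:E <= c%:E)%E.
  by have [c c0 h] := integral_single_kernel_le k; exists c.
exists (1 + \sum_(k < m) c k).
  by rewrite ltr_wpDr// sumr_ge0// => k _; exact: ltW (hc k).1.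
move=> g mg g0.
pose S x y : R := \sum_(k < m) W k x y.
have S0 x y : 0 <= S x y by apply: sumr_ge0 => k _; exact: single_kernel_ge0.
pose F (p : Rn * Rn) : \bar R := ((S p.1 p.2)%:E * g p.2)%E.
have mF : measurable_fun setT F by exact: measurable_single_kernel_integrand.
have F0 p : (0 <= F p)%E by rewrite mule_ge0 ?lee_fin ?S0.
rewrite (fubini_tonelli F mF F0) /F/=.
rewrite -ge0_integralZl//; last first.
  by rewrite lee_fin addr_ge0// sumr_ge0// => k _; exact: ltW (hc k).1.
have mW2 k y : measurable_fun setT (fun x : Rn => (W k x y)%:E).
  apply/measurable_EFinP; apply: measurable_single_kernel.
    exact: measurable_id.
  exact: measurable_cst.
have mS y : measurable_fun setT (fun x : Rn => (S x y)%:E).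
  apply/measurable_EFinP; apply: measurable_sum => k.
  by apply/measurable_EFinP; exact: mW2.
apply: ge0_le_integral.
- exact: measurableT.
- by move=> y _; apply: integral_ge0 => x _; exact: (F0 (x, y)).
- have := @measurable_fun_fubini_tonelli_G _ _ _ _ _ leb F mF F0.
  exact.
- by apply: emeasurable_funM; [exact: measurable_cst|exact: mg].
move=> y _; under eq_integral do rewrite muleC.
rewrite (ge0_integralZl _ measurableT (mS y)); last 2 first.
- by move=> x _; rewrite lee_fin S0.
- exact: g0.
rewrite muleC; apply: lee_wpmul2r; first exact: g0.
under eq_integral do rewrite /S -sumEFin.
rewrite (ge0_integral_sum _ measurableT (mW2^~ y)); last first.
  by move=> k x _; rewrite lee_fin single_kernel_ge0.
rewrite EFinD -sumEFin; apply: le_trans (leeDr _ _); last by rewrite lee_fin.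
by apply: lee_sum => k _; exact: (hc k).2.
Qed.

End SingleKernel.

(** * Oscillation of the fractional integral on one cube *)

Section CubeEstimate.
Context {R : realType} {m n : nat} (A : 'I_m -> 'M[R]_n) (alpha : 'I_m -> R).
Local Notation Rn := (lebesgue_cV_type R n).
Local Notation leb := (lebesgue_cV R n).
Local Notation K := (frac_kernel A alpha).
Hypothesis n_gt0 : (0 < n)%N.
Hypothesis A_unit : forall i, A i \in unitmx.
Hypothesis alpha_ge0 : forall i, 0 <= alpha i.
Hypothesis alpha_sum : \sum_(i < m) alpha i = n%:R.
Variable C : R.
Hypothesis C_ge1 : 1 <= C.
Hypothesis A_le : forall i v, enorm (A i *m v) <= C * enorm v.
Hypothesis invA_le : forall i v, enorm (invmx (A i) *m v) <= C * enorm v.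
Hypothesis AB_ge : forall k k', k != k' -> forall v,
  enorm v <= C * enorm ((A k - A k') *m v).
Variable f : Rn -> R.
Hypothesis mf : measurable_fun setT f.
Variables (a : 'cV[R]_n) (l : R).
Hypothesis l_gt0 : 0 < l.
Local Notation Q := (cube a l).
Local Notation d := (n%:R * l).
Variable I : 'I_m -> R.
Hypothesis I_ge0 : forall i, 0 <= I i.
Hypothesis IE : forall i,
  ereal_inf [set HL_max f (invmx (A i) *m w) | w in Q] = (I i)%:E.

Let d_gt0 : 0 < d. Proof. by rewrite mulr_gt0// ltr0n. Qed.
Let C_gt0 : 0 < C. Proof. exact: lt_le_trans C_ge1. Qed.

Lemma cube_enorm_le x : Q x -> enorm (x - a) <= d.
Proof.
move=> Qx; apply: le_trans (enorm_le_sum _) _.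
apply: (@le_trans _ _ (\sum_(i < n) l)); last by rewrite sumr_const card_ord mulr_natl.
apply: ler_sum => i _; have /andP[h1 h2] := Qx i.
by rewrite !mxE ger0_norm ?subr_ge0// lerBlDl.
Qed.

Let u i (y : Rn) := enorm (a - A i *m y).

Let mu_ i : measurable_fun setT (u i).
Proof. by apply: measurable_enorm_affine; [exact: measurable_cst|exact: measurable_id]. Qed.

Lemma integral_ball_le_I i r : d <= r ->
  (\int[leb]_(y in [set y : Rn | (u i y < r)%R]) `|f y|%:E <=
    ((2 * C) ^+ n * I i * r ^+ n)%:E)%E.
Proof.
move=> dr; have r0 := lt_le_trans d_gt0 dr.
apply: le_trans (integral_ball_le_inf_HL_max f mf (A i) C r a Q (A_unit i) C_gt0 _ r0 _) _.
- exact: invA_le.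
- by move=> w /cube_enorm_le h; exact: le_trans dr.
by rewrite IE -EFinM lee_fin le_eqVlt mulrA exprMn mulrAC eqxx.
Qed.

(** The radial weight that dominates the oscillation of the kernel over the cube. *)
Definition far_weight i (y : Rn) : R := if 2 * d <= u i y then u i y ^- n.+1 else 0.

Lemma far_weight_ge0 i y : 0 <= far_weight i y.
Proof. by rewrite /far_weight; case: ifP => // _; rewrite invr_ge0 exprn_ge0// enorm_ge0. Qed.

Lemma integral_far_weight_le i :
  (\int[leb]_y ((far_weight i y)%:E * `|f y|%:E) <=
    (2 ^+ n * (2 * C) ^+ n * I i / d)%:E)%E.
Proof.
have d2 : 0 < 2 * d by rewrite mulr_gt0.
have B0 : 0 <= (2 * C) ^+ n * I i by rewrite mulr_ge0// exprn_ge0// mulr_ge0// ltW.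
have g0 y : (0 <= `|f y|%:E)%E by rewrite lee_fin.
apply: le_trans (integral_tail_le leb n (u i) _ _ _ (mu_ i) (measurable_abs_fun f mf) g0 B0 d2 _) _.
  by move=> r dr; apply: integral_ball_le_I; move: d_gt0; lra.
rewrite lee_fin le_eqVlt; apply/orP; left; apply/eqP.
by rewrite exprS; field; rewrite ?gt_eqF// ltr0n.
Qed.

Definition is_far (y : Rn) : bool := [forall i, 2 * d <= u i y].

Lemma measurable_is_far : measurable_fun setT is_far.
Proof.
apply: (measurable_fun_bool true); rewrite setTI.
rewrite (_ : _ @^-1` _ = \bigcap_(i in [set: 'I_m]) ~` [set y | u i y < 2 * d]).
  apply: fin_bigcap_measurable => [|i _]; first exact: finite_finset.
  by apply: measurableC; exact: measurable_sublevel.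
apply/seteqP; split => y /=.
  by move=> /forallP far i _ /=; apply/negP; rewrite -leNgt; exact: far.
by move=> far; apply/forallP => i; rewrite leNgt; apply/negP; exact: far.
Qed.

Definition near_abs (y : Rn) : R := if is_far y then 0 else `|f y|.

Lemma near_abs_ge0 y : 0 <= near_abs y.
Proof. by rewrite /near_abs; case: ifP. Qed.

Lemma measurable_near_abs : measurable_fun setT near_abs.
Proof.
apply: measurable_fun_ifT; [exact: measurable_is_far|exact: measurable_cst|].
exact: measurableT_comp.
Qed.

(** The near region is a union of [m] preimages of balls of radius comparable to the
    side of the cube. *)
Lemma integral_near_abs_le :
  (\int[leb]_y (near_abs y)%:E <= ((4 * C * d) ^+ n * \sum_(i < m) I i)%:E)%E.
Proof.
have mS i : measurable [set y | u i y < 2 * d] by exact: measurable_sublevel.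
pose F i (y : Rn) : \bar R := ((fun y => `|f y|%:E) \_ [set y | u i y < 2 * d]) y.
have F0 i y : (0 <= F i y)%E by apply: erestrict_ge0 => z _; rewrite lee_fin.
have mF i : measurable_fun setT (F i).
  by apply/(measurable_restrictT _ (mS i)); apply: measurable_funTS; exact: measurable_abs_fun.
apply: (@le_trans _ _ (\int[leb]_y \sum_(i < m) F i y)%E).
  apply: ge0_le_integral.
  - exact: measurableT.
  - by move=> y _; rewrite lee_fin near_abs_ge0.
  - by apply/measurable_EFinP; exact: measurable_near_abs.
  - by apply: emeasurable_sum => i; exact: mF.
  move=> y _; rewrite /near_abs; case: ifPn => [_|]; first exact: sume_ge0.
  rewrite negb_forall => /existsP[i]; rewrite -ltNge => ui.
  rewrite (bigD1 i)//= {1}/F patchE mem_set//.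
  by rewrite leeDl// sume_ge0.
rewrite (ge0_integral_sum _ measurableT mF (fun i y _ => F0 i y)).
rewrite mulr_sumr -sumEFin; apply: lee_sum => i _.
rewrite -integral_mkcond; apply: le_trans (integral_ball_le_I i (2 * d) _) _.
  by move: d_gt0; lra.
rewrite lee_fin le_eqVlt mulrAC -exprMn; apply/orP; left; apply/eqP.
by congr (_ ^+ _ * _); ring.
Qed.

(** The constant subtracted from the fractional integral on the cube is the integral
    of this function. *)
Definition far_a (y : Rn) : R := if is_far y then K a y * f y else 0.

Lemma measurable_frac_kernel z : measurable_fun [set: Rn] (fun y : Rn => K z y).
Proof.
apply: measurable_prod => i _; apply: (measurableT_comp (measurable_powR _)).
by apply: measurable_enorm_affine; [exact: measurable_cst|exact: measurable_id].
Qed.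

Section PointEstimate.
Variable x : Rn.
Hypothesis Qx : Q x.
Hypothesis int_x : leb.-integrable setT (fun y : Rn => (K x y * f y)%:E).

Let mfar_a : measurable_fun setT far_a.
Proof.
apply: measurable_fun_ifT; [exact: measurable_is_far| |exact: measurable_cst].
by apply: measurable_funM; [exact: measurable_frac_kernel|exact: mf].
Qed.

Let int_a : leb.-integrable setT (EFin \o far_a).
Proof.
apply: (@le_integrable _ _ _ leb setT measurableT _ (fun y => (2 ^+ n)%:E * (K x y * f y)%:E)%E).
- exact/measurable_EFinP.
- move=> y _; rewrite /= lee_fin /far_a; case: ifPn => [/forallP far|_].
    rewrite [in leRHS]mulrA !normrM; apply: ler_wpM2r; first exact: normr_ge0.
    rewrite !(ger0_norm (frac_kernel_ge0 _ _ _ _)) (ger0_norm (exprn_ge0 _ _))//.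
    exact: (frac_kernel_far_comparable A alpha alpha_ge0 alpha_sum d x a y d_gt0
      (cube_enorm_le x Qx) far).
  by rewrite normr0.
- exact: integrableZl.
Qed.

(** The far part of the integrand is controlled by [frac_kernel_far_lipschitz]; on the
    near part nothing cancels and the absolute value stays inside the integral. *)
Lemma frac_int_sub_le :
  (`|frac_int A alpha f x - \int[leb]_y far_a y|%:E <=
    (2 ^+ n * n%:R * (2 ^+ n * (2 * C) ^+ n) * \sum_(i < m) I i)%:E
    + \int[leb]_y (K x y * near_abs y)%:E)%E.
Proof.
rewrite /frac_int -RintegralB; [|exact: measurableT|exact: int_x|exact: int_a].
set D := fun y : Rn => K x y * f y - far_a y.
have iD : leb.-integrable setT (EFin \o D).
  exact: (integrableB measurableT int_x int_a).
have mD : measurable_fun setT (EFin \o D) by have /integrableP[] := iD.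
have -> : (`|\int[leb]_y D y|%:E = `| \int[leb]_y (D y)%:E |)%E.
  rewrite /Rintegral -abse_EFin fineK//.
  exact: integrable_fin_num.
apply: le_trans (le_abse_integral _ measurableT mD) _.
pose c1 : R := 2 ^+ n * n%:R * d.
have c10 : 0 <= c1 by rewrite !mulr_ge0// ?exprn_ge0 ?(ltW l_gt0).
pose H i (y : Rn) : \bar R := ((far_weight i y)%:E * `|f y|%:E)%E.
have H0 i y : (0 <= H i y)%E by rewrite mule_ge0 ?lee_fin ?far_weight_ge0.
have mH i : measurable_fun setT (H i).
  apply: emeasurable_funM; last exact: measurable_abs_fun.
  apply/measurable_EFinP; apply: measurable_tail_weight; first exact: mu_.
  by rewrite mulr_gt0.
have mKn : measurable_fun setT (fun y : Rn => (K x y * near_abs y)%:E).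
  apply/measurable_EFinP.
  exact: (measurable_funM (measurable_frac_kernel x) measurable_near_abs).
apply: (@le_trans _ _ (\int[leb]_y (c1%:E * \sum_(i < m) H i y + (K x y * near_abs y)%:E))%E).
  apply: ge0_le_integral.
  - exact: measurableT.
  - by [].
  - exact: measurableT_comp.
  - apply: emeasurable_funD; last exact: mKn.
    apply: emeasurable_funM; first exact: measurable_cst.
    by apply: emeasurable_sum => i; exact: mH.
  move=> y _; rewrite /= /D /far_a /near_abs; case: ifPn => far.
    have {}far j : 2 * d <= enorm (a - A j *m y) by have /forallP := far; apply.
    rewrite mulr0 adde0 -mulrBl normrM EFinM.
    rewrite (_ : (\sum_(i < m) H i y =
        (\sum_(i < m) enorm (a - A i *m y) ^- n.+1)%:E * `|f y|%:E)%E).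
      rewrite muleA; apply: lee_wpmul2r; first by rewrite lee_fin.
      rewrite -EFinM lee_fin.
      exact: (frac_kernel_far_lipschitz A alpha alpha_ge0 alpha_sum d x a y d_gt0
        (cube_enorm_le x Qx) far n_gt0).
    rewrite -EFinM mulr_suml -sumEFin; apply: eq_bigr => i _.
    by rewrite /H /far_weight /u far EFinM.
  rewrite subr0 normrM (ger0_norm (frac_kernel_ge0 _ _ _ _)).
  by rewrite leeDr// mule_ge0 ?lee_fin// sume_ge0.
rewrite ge0_integralD; last 5 first.
- exact: measurableT.
- by move=> y _; rewrite mule_ge0 ?lee_fin// sume_ge0.
- apply: emeasurable_funM; first exact: measurable_cst.
  by apply: emeasurable_sum => i; exact: mH.
- by move=> y _; rewrite lee_fin mulr_ge0 ?frac_kernel_ge0 ?near_abs_ge0.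
- exact: mKn.
apply: leeD => //.
rewrite ge0_integralZl; last 4 first.
- exact: measurableT.
- by apply: emeasurable_sum => i; exact: mH.
- by move=> y _; exact: sume_ge0.
- by rewrite lee_fin.
rewrite (ge0_integral_sum _ measurableT mH (fun i y _ => H0 i y)).
apply: (@le_trans _ _ (c1%:E * \sum_(i < m) (2 ^+ n * (2 * C) ^+ n * I i / d)%:E)%E).
  apply: lee_wpmul2l; first by rewrite lee_fin.
  by apply: lee_sum => i _; exact: integral_far_weight_le.
rewrite sumEFin -EFinM lee_fin -mulr_suml -mulr_sumr le_eqVlt; apply/orP; left; apply/eqP.
by rewrite /c1; field; rewrite ?gt_eqF// ltr0n.
Qed.

End PointEstimate.

Local Notation W := (single_kernel A alpha C).

(** The single-singularity operators, summed and applied to the near part of [f]. *)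
Definition near_single (x : Rn) : \bar R :=
  (\int[leb]_y ((\sum_(k < m) W k x y)%:E * (near_abs y)%:E))%E.

Let near0 y : (0 <= (near_abs y)%:E)%E.
Proof. by rewrite lee_fin near_abs_ge0. Qed.

Let mnear : measurable_fun setT (EFin \o near_abs).
Proof. by apply/measurable_EFinP; exact: measurable_near_abs. Qed.

Let W0 x y : 0 <= \sum_(k < m) W k x y.
Proof. by apply: sumr_ge0 => k _; exact: single_kernel_ge0. Qed.

Let WN0 x y : (0 <= (\sum_(k < m) W k x y)%:E * (near_abs y)%:E)%E.
Proof. by apply: mule_ge0; [rewrite lee_fin; exact: W0|exact: near0]. Qed.

Lemma near_single_ge0 x : (0 <= near_single x)%E.
Proof. by apply: integral_ge0 => y _; exact: WN0. Qed.

Lemma measurable_near_single : measurable_fun setT near_single.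
Proof.
have mF := measurable_single_kernel_integrand A alpha C _ mnear.
have := @measurable_fun_fubini_tonelli_F _ _ _ _ _ leb _ mF (fun p => WN0 p.1 p.2).
exact.
Qed.

Lemma integral_frac_kernel_near_le (x : Rn) (r : R) : 0 < r -> r <= enorm x ->
  (\int[leb]_y (K x y * near_abs y)%:E <=
    ((1 + 2 * C ^+ 2) ^+ n * r ^- n)%:E * \int[leb]_y (near_abs y)%:E
    + near_single x)%E.
Proof.
move=> r0 rx; set b := _ * r ^- n.
have b0 : 0 <= b.
  by rewrite mulr_ge0 ?invr_ge0 ?exprn_ge0 ?(ltW r0)// addr_ge0// mulr_ge0// exprn_ge0// ltW.
have mWx : measurable_fun setT (fun y : Rn => (\sum_(k < m) W k x y)%:E * (near_abs y)%:E)%E.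
  apply: emeasurable_funM; last exact: mnear.
  apply/measurable_EFinP; apply: measurable_sum => k.
  by apply: measurable_single_kernel; [exact: measurable_cst|exact: measurable_id].
rewrite -ge0_integralZl; last 4 first.
- exact: measurableT.
- exact: mnear.
- by move=> y _; exact: near0.
- by rewrite lee_fin.
rewrite /near_single -ge0_integralD; last 5 first.
- exact: measurableT.
- by move=> y _; apply: mule_ge0; [rewrite lee_fin|exact: near0].
- by apply: emeasurable_funM; [exact: measurable_cst|exact: mnear].
- by move=> y _; exact: WN0.
- exact: mWx.
apply: ge0_le_integral.
- exact: measurableT.
- by move=> y _; rewrite lee_fin mulr_ge0 ?frac_kernel_ge0 ?near_abs_ge0.
- apply/measurable_EFinP.
  exact: (measurable_funM (measurable_frac_kernel x) measurable_near_abs).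
- apply: emeasurable_funD; last exact: mWx.
  by apply: emeasurable_funM; [exact: measurable_cst|exact: mnear].
move=> y _; rewrite -!EFinM -EFinD lee_fin -mulrDl ler_wpM2r ?near_abs_ge0//.
have x0 : (x : 'cV[R]_n) != 0.
  by apply/eqP => x0; move: rx; rewrite x0 enorm0 leNgt r0.
apply: (le_trans (frac_kernel_le_single A alpha alpha_ge0 alpha_sum C C_ge1 A_le AB_ge x y x0)).
rewrite lerD2r ler_wpM2l ?exprn_ge0 ?addr_ge0// ?mulr_ge0 ?exprn_ge0 ?(ltW C_gt0)//.
have xr0 : 0 < enorm x by exact: lt_le_trans rx.
rewrite lef_pV2 ?posrE ?exprn_gt0//.
by apply: lerXn2r => //; rewrite nnegrE ltW.
Qed.

Variables (s cW : R).
Hypotheses (s_gt0 : 0 < s) (s_le : s <= 2^-1) (cW_gt0 : 0 < cW).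
Hypothesis W_bounded : forall g : Rn -> \bar R, measurable_fun setT g ->
  (forall y, (0 <= g y)%E) ->
  (\int[leb]_x \int[leb]_y ((\sum_(k < m) W k x y)%R%:E * g y) <=
   cW%:E * \int[leb]_y g y)%E.
Hypothesis intf : {ae leb, forall x,
  leb.-integrable setT (fun y : Rn => (K x y * f y)%:E)}.

Let S := \sum_(i < m) I i.

(** The three terms account for the far region, for the part [enorm x ^- n] of the
    kernel outside the ball of radius [s / 8 * l] around the origin, and for
    Chebyshev's inequality applied to [near_single]. *)
Definition oscillation_constant : R :=
  2 ^+ n * n%:R * (2 ^+ n * (2 * C) ^+ n)
  + (1 + 2 * C ^+ 2) ^+ n * (32 * C * n%:R / s) ^+ n
  + cW * (4 * C * n%:R) ^+ n * (4 / s).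

Lemma oscillation_constant_gt0 : 0 < oscillation_constant.
Proof.
have n0 : 0 < n%:R :> R by rewrite ltr0n.
rewrite ltr_wpDl ?addr_ge0 ?mulr_ge0 ?exprn_ge0 ?mulr_ge0 ?invr_ge0 ?addr_ge0//;
  rewrite ?mulr_ge0 ?exprn_ge0 ?ltW//.
by rewrite !mulr_gt0 ?invr_gt0// exprn_gt0// !mulr_gt0.
Qed.

(** Chebyshev's inequality; the threshold is chosen so that the exceptional set takes
    at most the fraction [s / 4] of the cube, and [e] keeps it positive when [f]
    vanishes. *)
Lemma lebesgue_near_single_le (e : R) : 0 < e ->
  (leb [set x | ((cW * (4 * C * n%:R) ^+ n * (4 / s) * S + e)%:E <= near_single x)%E]
    <= (s / 4 * l ^+ n)%:E)%E.
Proof.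
move=> e0; set b := _ + e.
have S0 : 0 <= S by exact: sumr_ge0.
have c0 : 0 <= cW * (4 * C * n%:R) ^+ n * (4 / s) * S.
  rewrite !mulr_ge0 ?invr_ge0 ?(ltW cW_gt0) ?(ltW s_gt0)//.
  by rewrite exprn_ge0// !mulr_ge0// ltW.
have b0 : 0 < b by rewrite ltr_wpDl.
have ln0 : 0 < l ^+ n by exact: exprn_gt0.
have := @le_integral_comp_abse _ _ _ leb setT measurableT near_single b id
  (@measurable_id _ _ _) (fun r r0 => r0) (fun _ _ _ _ h => h) measurable_near_single b0.
rewrite setTI.
under [X in (_ <= X)%E -> _]eq_integral do rewrite gee0_abs ?near_single_ge0//.
set Y := (X in (_ * leb X)%E) => h.
have VY : [set x | (b%:E <= near_single x)%E] `<=` Y.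
  by move=> x /= bx; rewrite /Y/= gee0_abs ?near_single_ge0.
apply: le_trans (le_lebesgue _ _ VY) _.
rewrite -(@lee_pmul2l _ b%:E) ?lte_fin//; apply: le_trans h _.
apply: le_trans (W_bounded _ mnear near0) _.
apply: le_trans (lee_wpmul2l _ integral_near_abs_le) _; first by rewrite lee_fin ltW.
rewrite -!EFinM lee_fin -/S.
have -> : cW * ((4 * C * (n%:R * l)) ^+ n * S) =
    (cW * (4 * C * n%:R) ^+ n * (4 / s) * S) * (s / 4 * l ^+ n).
  by rewrite (mulrA _ n%:R) exprMn; field; rewrite gt_eqF.
by rewrite ler_wpM2r ?mulr_ge0 ?(ltW s_gt0) ?(ltW ln0)// lerDl ltW.
Qed.

(** The exceptional points lie in a null set where the integral diverges, in a small
    ball around the origin, or where [near_single] is large. The last two have measure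
    at most [s / 4] times that of the cube each. *)
Lemma frac_int_oscillation_lt (e : R) : 0 < e ->
  (leb (Q `&` [set x | (oscillation_constant * S + e <
      `|frac_int A alpha f x - \int[leb]_y far_a y|)%R]) < s%:E * leb Q)%E.
Proof.
move=> e0; have S0 : 0 <= S by exact: sumr_ge0.
have ln0 : 0 < l ^+ n by exact: exprn_gt0.
have [N [mN N0 subN]] := intf.
set rho := s / 8 * l; have rho0 : 0 < rho by rewrite mulr_gt0// divr_gt0.
pose B := [set x : Rn | enorm (x - 0) < rho].
have mB : measurable B by apply: measurable_sublevel; exact: measurable_enorm_dist.
set b := cW * (4 * C * n%:R) ^+ n * (4 / s) * S + e.
pose V := [set x | (b%:E <= near_single x)%E].
have mV : measurable V.
  have := measurable_near_single measurableT _ (@emeasurable_itv _ `[b%:E, +oo[).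
  rewrite setTI; congr measurable; apply/seteqP; split => x /=; rewrite in_itv/= ?andbT//.
have B_le : (leb B <= (s / 4 * l ^+ n)%:E)%E.
  apply: le_trans (lebesgue_ball_le 0 rho rho0) _; rewrite lee_fin /rho.
  have -> : 2 * (s / 8 * l) = s / 4 * l by field.
  rewrite exprMn ler_wpM2r ?(ltW ln0)// -{2}[s / 4]expr1.
  by apply: ler_wiXn2l => //; move: s_gt0 s_le; lra.
have sub : Q `&` [set x | (oscillation_constant * S + e <
      `|frac_int A alpha f x - \int[leb]_y far_a y|)%R] `<=` N `|` (B `|` V).
  move=> x [Qx /= xlt]; have [Nx|Nx] := pselect (N x); first by left.
  right; have [Bx|Bx] := pselect (B x); first by left.
  right; rewrite /V/= leNgt; apply/negP => Vx.
  have int_x : leb.-integrable setT (fun y : Rn => (K x y * f y)%:E).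
    by apply: contrapT => h; apply: Nx; exact: subN.
  have rx : rho <= enorm x by rewrite leNgt; apply/negP => h; apply: Bx; rewrite /B/= subr0.
  move: xlt; apply/negP; rewrite -leNgt -lee_fin.
  apply: le_trans (frac_int_sub_le x Qx int_x) _.
  apply: le_trans (leeD (lexx _) (integral_frac_kernel_near_le x rho rho0 rx)) _.
  apply: le_trans (leeD (lexx _) (leeD (lee_wpmul2l _ integral_near_abs_le) (ltW Vx))) _.
    rewrite lee_fin mulr_ge0 ?invr_ge0 ?exprn_ge0 ?(ltW rho0)//.
    by rewrite addr_ge0// mulr_ge0// exprn_ge0// ltW.
  rewrite -EFinM -!EFinD lee_fin -/S /b /oscillation_constant.
  have -> : (1 + 2 * C ^+ 2) ^+ n / rho ^+ n * ((4 * C * (n%:R * l)) ^+ n * S) =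
      (1 + 2 * C ^+ 2) ^+ n * (32 * C * n%:R / s) ^+ n * S.
    rewrite -!mulrA; congr (_ * _); rewrite !mulrA; congr (_ * _).
    rewrite -exprVn -exprMn; congr (_ ^+ _); rewrite /rho; field.
    by rewrite !gt_eqF.
  by rewrite !mulrDl !addrA.
apply: le_lt_trans (le_lebesgue _ _ sub) _.
have NBV : (leb (N `|` (B `|` V)) <= leb N + leb (B `|` V))%E.
  by apply: measureU2 => //; exact: measurableU.
apply: le_lt_trans NBV _; have -> : leb N = 0%E by exact: N0.
rewrite add0e; have BV : (leb (B `|` V) <= leb B + leb V)%E by exact: measureU2.
apply: le_lt_trans BV _.
apply: le_lt_trans (leeD B_le (lebesgue_near_single_le e e0)) _.
rewrite lebesgue_cV_cube// -EFinD -EFinM lte_fin -mulrDl ltr_pM2r//.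
by move: s_gt0; lra.
Qed.

End CubeEstimate.

(** * A logarithmically divergent truncation *)

Section LogKernel.
Context {R : realType} (n : nat).

(** A dyadic truncation of [u ^- n]: its integral over [R^n] is comparable with [K],
    the number of scales, while it stays below [2 * u ^- n] uniformly in [K]. The
    singular point [u = 0] is left out because the fractional kernel vanishes there. *)
Definition log_kernel (K : nat) (u : R) : R :=
  \sum_(j < K) if (0 < u < 2 ^- j) then (2 ^+ j) ^+ n else 0.

Lemma log_kernel_ge0 K u : 0 <= log_kernel K u.
Proof. by apply: sumr_ge0 => j _; case: ifP => // _; rewrite !exprn_ge0. Qed.

Lemma sum_expr2_le (K : nat) : (0 < n)%N ->
  \sum_(j < K) (2 ^+ j) ^+ n <= (2 ^+ K) ^+ n :> R.
Proof.
move=> n_gt0; elim: K => [|K IH]; first by rewrite big_ord0 !exprn_ge0.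
rewrite big_ord_recr/=; apply: le_trans (lerD IH (lexx _)) _.
rewrite -mulr2n -[_ *+ 2]mulr_natl (exprS 2 K) exprMn ler_wpM2r ?exprn_ge0//.
by rewrite -{1}[2]expr1 ler_weXn2l// ler1n.
Qed.

(** The terms form a geometric progression, so the sum is at most twice its last
    term, the one of the smallest scale [2 ^- j] still above [u]. *)
Lemma log_kernel_le K u : (0 < n)%N -> 0 < u -> log_kernel K u <= 2 * u ^- n.
Proof.
move=> n_gt0 u0; have un : 0 < u ^+ n by exact: exprn_gt0.
elim: K => [|K IH]; first by rewrite /log_kernel big_ord0 mulr_ge0// invr_ge0 ltW.
rewrite /log_kernel big_ord_recr/= -/(log_kernel K u) u0/=.
case: ifPn => [uK|_]; last by rewrite addr0.
have K2 : 0 < 2 ^+ K :> R by exact: exprn_gt0.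
have h : (2 ^+ K) ^+ n <= u ^- n.
  rewrite -[leLHS]invrK lef_pV2 ?posrE ?invr_gt0 ?exprn_gt0//.
  by rewrite -exprVn lerXn2r// ?nnegrE ?invr_ge0 ltW.
rewrite mulr_natl mulr2n lerD//; apply: le_trans h.
apply: le_trans (sum_expr2_le K n_gt0); apply: ler_sum => j _.
by case: ifP => // _; rewrite !exprn_ge0.
Qed.

Context {d} {T : measurableType d} (mu : {measure set T -> \bar R}).

Lemma integral_if_cst (b : T -> bool) (c : R) : 0 <= c ->
  measurable [set x | b x] ->
  (\int[mu]_x (if b x then c else 0)%:E = c%:E * mu [set x | b x])%E.
Proof.
move=> c0 mb; rewrite -integral_cst// [RHS]integral_mkcond.
apply: eq_integral => x _; rewrite patchE.
case: ifPn => bx; first by rewrite mem_set.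
by rewrite memNset//; exact/negP.
Qed.

Variable u : T -> R.
Hypothesis mu_ : measurable_fun setT u.

Lemma measurable_annulus (r : R) : measurable [set x | 0 < u x < r].
Proof.
have := mu_ measurableT _ (measurable_itv `]0, r[).
rewrite setTI; congr measurable; apply/seteqP; split => x /=; by rewrite in_itv.
Qed.

Lemma measurable_log_kernel K : measurable_fun setT (fun x => log_kernel K (u x)).
Proof.
apply: measurable_sum => j; apply: measurable_fun_ifT; [|exact: measurable_cst..].
by apply: (measurable_fun_bool true); rewrite setTI; exact: measurable_annulus.
Qed.

Lemma integral_log_kernel K : (\int[mu]_x (log_kernel K (u x))%:E =
  \sum_(j < K) ((2 ^+ j) ^+ n)%:E * mu [set x | (0 < u x < 2 ^- j)%R])%E.
Proof.
under eq_integral do rewrite /log_kernel -sumEFin.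
rewrite ge0_integral_sum.
- apply: eq_bigr => j _; apply: integral_if_cst; first by rewrite !exprn_ge0.
  exact: measurable_annulus.
- exact: measurableT.
- move=> j; apply/measurable_EFinP; apply: measurable_fun_ifT; [|exact: measurable_cst..].
  by apply: (measurable_fun_bool true); rewrite setTI; exact: measurable_annulus.
- by move=> j x _; rewrite lee_fin; case: ifP => // _; rewrite !exprn_ge0.
Qed.

End LogKernel.

Section LogKernelLebesgue.
Context {R : realType} {n : nat}.
Local Notation Rn := (lebesgue_cV_type R n).
Local Notation leb := (lebesgue_cV R n).
Hypothesis n_gt0 : (0 < n)%N.

(** The cube of side [e = r / (4 n)] whose lower corner is [p + e] fits in the punctured
    ball. *)
Lemma lebesgue_annulus_ge (p : 'cV[R]_n) (r : R) : 0 < r ->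
  (((r / (4 * n%:R)) ^+ n)%:E <= leb [set x : Rn | (0 < enorm (x - p) < r)%R])%E.
Proof.
move=> r0; have n0 : 0 < n%:R :> R by rewrite ltr0n.
set e := r / _; have e0 : 0 < e by rewrite divr_gt0// mulr_gt0.
have re : r = 4 * n%:R * e by rewrite /e mulrC divfK// gt_eqF// mulr_gt0.
rewrite -(lebesgue_cV_cube (p + const_mx e) e0); apply: le_lebesgue.
move=> x xc /=.
have xe i : e <= (x - p) i ord0 <= 2 * e.
  by have := xc i; rewrite !mxE => /andP[h1 h2]; apply/andP; split; lra.
apply/andP; split.
  have := normr_coord_le_enorm (x - p) (Ordinal n_gt0).
  apply: lt_le_trans; apply: (lt_le_trans e0).
  by case/andP: (xe (Ordinal n_gt0)) => h _; rewrite (le_trans h)// ler_norm.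
apply: (le_lt_trans (enorm_le_sum _)).
apply: (@le_lt_trans _ _ (\sum_(i < n) 2 * e)).
  apply: ler_sum => i _; case/andP: (xe i) => h1 h2.
  by rewrite ger0_norm// (le_trans (ltW e0)).
rewrite sumr_const card_ord -mulr_natl re; nra.
Qed.

Lemma integral_log_kernel_ge (p : 'cV[R]_n) K :
  ((K%:R * (4 * n%:R) ^- n)%:E <= \int[leb]_x (log_kernel n K (enorm (x - p)))%:E)%E.
Proof.
rewrite integral_log_kernel; last exact: measurable_enorm_dist.
have -> : K%:R * (4 * n%:R) ^- n = \sum_(j < K) (4 * n%:R) ^- n :> R.
  by rewrite sumr_const card_ord mulr_natl.
rewrite -sumEFin; apply: lee_sum => j _.
have j0 : 0 < 2 ^+ j :> R by exact: exprn_gt0.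
apply: (le_trans _ (lee_wpmul2l _ (lebesgue_annulus_ge p (2 ^- j) _))).
- rewrite -EFinM lee_fin -exprMn mulrA mulfV ?gt_eqF// mul1r.
  by rewrite exprVn.
- by rewrite lee_fin !exprn_ge0.
- by rewrite invr_gt0.
Qed.

Variables (A : 'M[R]_n) (C : R).
Hypothesis C_gt0 : 0 < C.
Hypothesis A_unit : A \in unitmx.
Hypothesis invA_le : forall v, enorm (invmx A *m v) <= C * enorm v.

Lemma lebesgue_preimage_ball_le (x : 'cV[R]_n) (r : R) : 0 < r ->
  (leb [set y : Rn | (enorm (x - A *m y) < r)%R] <= ((2 * (C * r)) ^+ n)%:E)%E.
Proof.
move=> r0; apply: le_trans (lebesgue_ball_le (invmx A *m x) (C * r) _); last first.
  by rewrite mulr_gt0.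
apply: le_lebesgue.
exact: preimage_ball_sub.
Qed.

Lemma integral_log_kernel_le (x : 'cV[R]_n) K :
  (\int[leb]_y (log_kernel n K (enorm (x - A *m y)))%:E <= (K%:R * (2 * C) ^+ n)%:E)%E.
Proof.
rewrite integral_log_kernel; last first.
  by apply: measurable_enorm_affine; [exact: measurable_cst|exact: measurable_id].
have -> : K%:R * (2 * C) ^+ n = \sum_(j < K) (2 * C) ^+ n.
  by rewrite sumr_const card_ord mulr_natl.
rewrite -sumEFin; apply: lee_sum => j _.
have j0 : 0 < 2 ^+ j :> R by exact: exprn_gt0.
apply: (@le_trans _ _ (((2 ^+ j) ^+ n)%:E * ((2 * (C * 2 ^- j)) ^+ n)%:E)%E).
  apply: lee_wpmul2l; first by rewrite lee_fin !exprn_ge0.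
  apply: (le_trans (le_lebesgue _ _ _)); last first.
    by apply: (lebesgue_preimage_ball_le x); rewrite invr_gt0.
  by move=> y /= /andP[].
by rewrite -EFinM -exprMn mulrCA (mulrCA _ C) mulfV ?gt_eqF// mulr1.
Qed.

End LogKernelLebesgue.

(** * The critical exponent *)

Lemma ae_imply {d} {T : measurableType d} {R : realType}
  (mu : {measure set T -> \bar R}) (P Q : T -> Prop) :
  {ae mu, forall x, P x} -> (forall x, P x -> Q x) -> {ae mu, forall x, Q x}.
Proof. by move=> aeP PQ; apply: filterS aeP. Qed.

Section CriticalVanishing.
Context {R : realType} {n : nat}.
Local Notation Rn := (lebesgue_cV_type R n).
Local Notation leb := (lebesgue_cV R n).
Hypothesis n_gt0 : (0 < n)%N.
Variables (A : 'M[R]_n) (C : R).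
Hypothesis C_gt0 : 0 < C.
Hypothesis A_unit : A \in unitmx.
Hypothesis A_le : forall v, enorm (A *m v) <= C * enorm v.
Hypothesis invA_le : forall v, enorm (invmx A *m v) <= C * enorm v.

(** Let [Phi K x] be the integral of [log_kernel n K (enorm (x - A *m y)) * g y]. It is
    bounded in [K] wherever the critical integral converges, so [Phi K / K] tends to 0
    almost everywhere. It is also at most [K (2 C) ^+ n] and supported in a fixed ball,
    so dominated convergence shows that the integrals of [Phi K / K] tend to 0. By Tonelli
    these integrals are at least a fixed multiple of the integral of [g]. *)
Lemma integral_eq0_of_critical_integrable (g : Rn -> R) (M : R) :
  measurable_fun setT g -> (forall y, 0 <= g y <= 1) ->
  0 < M -> (forall y, M <= enorm y -> g y = 0) ->
  {ae leb, forall x, (\int[leb]_y (enorm (x - A *m y) `^ (- n%:R) * g y)%:E < +oo)%E} ->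
  (\int[leb]_y (g y)%:E = 0)%E.
Proof.
move=> mg g01 M0 gM fin.
have g_ge0 y : 0 <= g y by case/andP: (g01 y).
have g_le1 y : g y <= 1 by case/andP: (g01 y).
pose k K x y : R := log_kernel n K (enorm (x - A *m y)) * g y.
have k0 K x y : 0 <= k K x y by rewrite mulr_ge0// log_kernel_ge0.
have mk2 K : measurable_fun setT (fun p : Rn * Rn => (k K p.1 p.2)%:E).
  apply/measurable_EFinP; apply: measurable_funM.
    apply: measurable_log_kernel; apply: measurable_enorm_affine.
      exact: measurable_fst.
    exact: measurable_snd.
  exact: (measurableT_comp mg measurable_snd).
have k2_ge0 K (p : Rn * Rn) : (0 <= (k K p.1 p.2)%:E)%E by rewrite lee_fin.
have muy x : measurable_fun setT (fun y : Rn => enorm (x - A *m y)).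
  by apply: measurable_enorm_affine; [exact: measurable_cst|exact: measurable_id].
have mky K x : measurable_fun setT (fun y : Rn => (k K x y)%:E).
  by apply/measurable_EFinP; apply: measurable_funM; [exact: measurable_log_kernel|exact: mg].
pose Phi K (x : Rn) : \bar R := (\int[leb]_y (k K x y)%:E)%E.
have Phi0 K x : (0 <= Phi K x)%E.
  by apply: integral_ge0 => y _; rewrite lee_fin.
have mPhi K : measurable_fun setT (Phi K).
  have := @measurable_fun_fubini_tonelli_F _ _ _ _ _ leb _ (mk2 K) (k2_ge0 K).
  exact.
have Phi_ge K : ((K%:R * (4 * n%:R) ^- n)%:E * \int[leb]_y (g y)%:E <= \int[leb]_x Phi K x)%E.
  rewrite /Phi.
  rewrite (fubini_tonelli _ (mk2 K) (k2_ge0 K)).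
  rewrite -ge0_integralZl; last 4 first.
  - exact: measurableT.
  - exact/measurable_EFinP.
  - by move=> y _; rewrite lee_fin.
  - by rewrite lee_fin mulr_ge0// invr_ge0 exprn_ge0// mulr_ge0.
  apply: ge0_le_integral.
  - exact: measurableT.
  - by move=> y _; rewrite mule_ge0 ?lee_fin// mulr_ge0// invr_ge0 exprn_ge0// mulr_ge0.
  - by apply: emeasurable_funM; [exact: measurable_cst|exact/measurable_EFinP].
  - have := @measurable_fun_fubini_tonelli_G _ _ _ _ _ leb _ (mk2 K) (k2_ge0 K).
    exact.
  move=> y _; rewrite /k/=; under eq_integral do rewrite mulrC EFinM.
  rewrite ge0_integralZl; last 4 first.
  - exact: measurableT.
  - apply/measurable_EFinP; apply: measurable_log_kernel; exact: measurable_enorm_dist.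
  - by move=> x _; rewrite lee_fin log_kernel_ge0.
  - by rewrite lee_fin.
  rewrite muleC; apply: lee_wpmul2l; first by rewrite lee_fin.
  exact: integral_log_kernel_ge.
(* [Phi K] is supported in this ball, since each term of [log_kernel] lives at
   distance less than 1. *)
pose P := [set x : Rn | enorm (x - 0) < C * M + 1].
have mP : measurable P.
  by apply: measurable_sublevel; exact: measurable_enorm_dist.
have Phi_le K x : (Phi K x <= (K%:R * (2 * C) ^+ n * \1_P x)%:E)%E.
  have [xP|xP] := pselect (P x).
    rewrite indicE mem_set// mulr1.
    apply: le_trans (integral_log_kernel_le _ _ C_gt0 A_unit invA_le x K).
    apply: ge0_le_integral.
    - exact: measurableT.
    - by move=> y _; rewrite lee_fin.
    - exact: mky.
    - by apply/measurable_EFinP; exact: measurable_log_kernel.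
    - by move=> y _; rewrite lee_fin ler_piMr// log_kernel_ge0.
  rewrite indicE memNset// mulr0 /Phi integral0_eq// => y _.
  have [yM|yM] := leP M (enorm y); first by rewrite /k gM// mulr0.
  congr EFin; rewrite /k /log_kernel big1 ?mul0r// => j _.
  case: ifPn => // /andP[_ xy]; exfalso; apply: xP.
  rewrite /P/= subr0 -(subrK (A *m y) x); apply: le_lt_trans (enormD _ _) _.
  rewrite addrC ler_ltD//.
    by rewrite (le_trans (A_le _))// ler_wpM2l ?ltW.
  by rewrite (lt_le_trans xy)// invf_le1 ?exprn_gt0// exprn_ege1// ler1n.
have Phi_F K x : (Phi K x <= 2%:E * \int[leb]_y (enorm (x - A *m y) `^ (- n%:R) * g y)%:E)%E.
  rewrite -ge0_integralZl; last 4 first.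
  - exact: measurableT.
  - apply/measurable_EFinP; apply: measurable_funM; last exact: mg.
    exact: (measurableT_comp (measurable_powR _) (muy x)).
  - by move=> y _; rewrite lee_fin mulr_ge0// powR_ge0.
  - by rewrite lee_fin.
  apply: ge0_le_integral.
  - exact: measurableT.
  - by move=> y _; rewrite lee_fin.
  - exact: mky.
  - apply: emeasurable_funM; first exact: measurable_cst.
    apply/measurable_EFinP; apply: measurable_funM; last exact: mg.
    exact: (measurableT_comp (measurable_powR _) (muy x)).
  move=> y _; rewrite -EFinM lee_fin /k mulrA ler_wpM2r//.
  have := enorm_ge0 (x - A *m y); rewrite le_eqVlt => /predU1P[<-|u0].
    rewrite /log_kernel big1 ?mulr_ge0 ?powR_ge0// => j _.
    by rewrite ltxx.
  by rewrite powR_invn ?enorm_ge0//; exact: log_kernel_le.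
pose b := (4 * n%:R) ^- n : R.
have b0 : 0 < b by rewrite invr_gt0 exprn_gt0// mulr_gt0// ltr0n.
pose D : R := (2 * C) ^+ n.
have D0 : 0 <= D by rewrite exprn_ge0// mulr_ge0// ltW.
pose psi K (x : Rn) : \bar R := ((K.+1%:R^-1)%:E * Phi K.+1 x)%E.
have psi0 K x : (0 <= psi K x)%E by rewrite mule_ge0 ?lee_fin.
have mpsi K : measurable_fun setT (psi K).
  by apply: emeasurable_funM; [exact: measurable_cst|exact: mPhi].
have psi_cvg : {ae leb, forall x, [set: Rn] x -> psi ^~ x @ \oo --> cst 0%E x}.
  apply: (ae_imply _ _ _ fin) => x Fx _.
  set F := (X in (X < _)%E) in Fx.
  have F0 : (0 <= F)%E.
    by apply: integral_ge0 => y _; rewrite lee_fin mulr_ge0// powR_ge0.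
  have Ff : F \is a fin_num by rewrite ge0_fin_numE.
  apply: (@squeeze_cvge _ _ _ _ (cst 0%E) _ (fun K => ((2 * fine F) * harmonic K)%:E)).
  - apply: nearW => K; rewrite psi0/= /psi.
    rewrite mulrC EFinM EFinM fineK//; apply: lee_wpmul2l; first by rewrite lee_fin.
    exact: Phi_F.
  - exact: cvg_cst.
  - apply: cvg_EFin; first exact: nearW.
    by rewrite -[X in _ --> X](mulr0 (2 * fine F)); apply: cvgMr; exact: cvg_harmonic.
have idom : leb.-integrable setT (fun x => (D * \1_P x)%:E).
  have mdom : measurable_fun setT (fun x => (D * \1_P x)%:E).
    apply/measurable_EFinP; apply: measurable_funM; first exact: measurable_cst.
    exact: measurable_indic.
  apply/integrableP; split => //.
  under eq_integral do rewrite gee0_abs ?lee_fin ?mulr_ge0// EFinM.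
  rewrite ge0_integralZl; last 4 first.
  - exact: measurableT.
  - by apply/measurable_EFinP; exact: measurable_indic.
  - by move=> x _; rewrite lee_fin.
  - by rewrite lee_fin.
  rewrite integral_indic// setIT lte_mul_pinfty//.
  apply: (@le_lt_trans _ _ ((2 * (C * M + 1)) ^+ n)%:E); last by rewrite ltry.
  by apply: lebesgue_ball_le; rewrite addr_gt0// mulr_gt0.
have psi_dom : {ae leb, forall x, forall K, [set: Rn] x -> (`|psi K x| <= (D * \1_P x)%:E)%E}.
  apply: aeW => x K _; rewrite gee0_abs// /psi.
  apply: (le_trans (lee_wpmul2l _ (Phi_le K.+1 x))); first by rewrite lee_fin.
  by rewrite -EFinM lee_fin !mulrA mulVf ?mul1r ?pnatr_eq0.
have [_ _] := @dominated_convergence _ _ _ leb setT measurableT psi (cst 0%E)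
  (fun x => (D * \1_P x)%:E) mpsi (measurable_cst _) psi_cvg idom psi_dom.
rewrite integral0 => psi_lim.
have Ig : (0 <= \int[leb]_y (g y)%:E)%E by apply: integral_ge0 => y _; rewrite lee_fin.
have : (b%:E * \int[leb]_y (g y)%:E <= 0)%E.
  rewrite -(cvg_lim _ psi_lim)//; apply: lime_ge; first by apply/cvg_ex; exists 0%E.
  apply: nearW => K; rewrite /= /psi ge0_integralZl; last 4 first.
  - exact: measurableT.
  - exact: mPhi.
  - by move=> x _.
  - by rewrite lee_fin.
  rewrite -lee_pdivrMl ?invr_gt0// invrK muleA -EFinM.
  exact: Phi_ge.
rewrite pmule_rle0 ?lte_fin// => Ig'.
by apply/eqP; rewrite eq_le Ig' Ig.
Qed.

(** The truncations [g M] of [|f|] are bounded, vanish outside a ball and have a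
    convergent critical integral wherever [f] does; countably many of them detect every
    point where [f] is nonzero. *)
Lemma ae_eq0_of_critical_integrable (f : Rn -> R) :
  measurable_fun setT f ->
  {ae leb, forall x, leb.-integrable setT
    (fun y => (enorm (x - A *m y) `^ (- n%:R) * f y)%:E)} ->
  {ae leb, forall y, f y = 0}.
Proof.
move=> mf intf.
pose g (M : nat) (y : Rn) : R := if enorm (y - 0) < M.+1%:R then Num.min 1 `|f y| else 0.
have mg M : measurable_fun setT (g M).
  apply: measurable_fun_ifT.
  - by apply: measurable_fun_ltr; [exact: measurable_enorm_dist|exact: measurable_cst].
  - by apply: measurable_minr; [exact: measurable_cst|exact: measurableT_comp].
  - exact: measurable_cst.
have g01 M y : 0 <= g M y <= 1.
  by rewrite /g; case: ifP => _; rewrite ?lexx ?ler01// le_min ler01 normr_ge0 ge_min lexx.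
have gf M y : g M y <= `|f y|.
  by rewrite /g; case: ifP => _ //; rewrite ge_min lexx orbT.
have g_eq0 M : {ae leb, forall y, [set: Rn] y -> (g M y)%:E = cst 0%E y}.
  apply/ae_eq_integral_abs; [exact: measurableT|exact/measurable_EFinP|].
  under eq_integral do rewrite gee0_abs ?lee_fin ?(andP (g01 M _)).1//.
  apply: (@integral_eq0_of_critical_integrable (g M) M.+1%:R) => //.
    by move=> y yM; rewrite /g subr0 ltNge yM.
  apply: (ae_imply _ _ _ intf) => x /integrableP[mx]; apply: le_lt_trans.
  apply: ge0_le_integral.
  - exact: measurableT.
  - by move=> y _; rewrite lee_fin mulr_ge0 ?powR_ge0// (andP (g01 M y)).1.
  - apply/measurable_EFinP; apply: measurable_funM; last exact: mg.
    apply: (measurableT_comp (measurable_powR _)).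
    by apply: measurable_enorm_affine; [exact: measurable_cst|exact: measurable_id].
  - exact: measurableT_comp.
  - by move=> y _; rewrite abse_EFin lee_fin normrM ger0_norm ?powR_ge0// ler_wpM2l ?powR_ge0.
apply: (ae_imply _ _ _ (ae_foralln g_eq0)) => y gy.
have /(_ I)[] := gy (Num.bound (enorm y)).
rewrite /g subr0 (lt_trans (archi_boundP (enorm_ge0 y))) ?ltr_nat//.
by rewrite /Num.min; case: ifPn => _ /eqP; rewrite ?oner_eq0 ?normr_eq0 => // /eqP.
Qed.

End CriticalVanishing.

(** * The sharp maximal estimate *)

Section Assembly.
Context {R : realType} {n : nat}.
Local Notation Rn := (lebesgue_cV_type R n).
Local Notation leb := (lebesgue_cV R n).

Lemma matrices_bound (m : nat) (A : 'I_m -> 'M[R]_n) :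
  (forall i, A i \in unitmx) -> (forall k k', k != k' -> A k - A k' \in unitmx) ->
  exists C : R, [/\ 1 <= C, (forall i v, enorm (A i *m v) <= C * enorm v),
    (forall i v, enorm (invmx (A i) *m v) <= C * enorm v) &
    (forall k k', k != k' -> forall v, enorm v <= C * enorm ((A k - A k') *m v))].
Proof.
move=> uA uAB.
have [C1 [C11 h1]] := enorm_mulmx_uniform _ A.
have [C2 [C21 h2]] := enorm_mulmx_uniform _ (fun i => invmx (A i)).
have [C3 [C31 h3]] := enorm_mulmx_uniform _ (fun p : 'I_m * 'I_m => invmx (A p.1 - A p.2)).
exists (C1 + C2 + C3); split.
- lra.
- by move=> i v; apply: le_trans (h1 i v) _; rewrite ler_wpM2r ?enorm_ge0//; lra.
- by move=> i v; apply: le_trans (h2 i v) _; rewrite ler_wpM2r ?enorm_ge0//; lra.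
- move=> k k' kk' v; rewrite -{1}(mulKmx (uAB _ _ kk') v).
  by apply: le_trans (h3 (k, k') _) _; rewrite ler_wpM2r ?enorm_ge0//; lra.
Qed.

Lemma ereal_inf_HL_max_ge0 (f : Rn -> R) (B : 'M[R]_n) (Q : set Rn) :
  (0 <= ereal_inf [set HL_max f (B *m w) | w in Q])%E.
Proof. by apply: le_ereal_inf_tmp => _ [w _ <-]; exact: HL_max_ge0. Qed.

Lemma frac_int_ae_eq0 (m : nat) (A : 'I_m -> 'M[R]_n) (alpha : 'I_m -> R)
    (f : Rn -> R) (x : Rn) :
  measurable_fun setT f -> {ae leb, forall y, f y = 0} -> frac_int A alpha f x = 0.
Proof.
move=> mf f0; rewrite /frac_int /Rintegral (ae_eq_integral (cst 0%E)).
- by rewrite integral0.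
- exact: measurableT.
- apply/measurable_EFinP.
  exact: (measurable_funM (measurable_frac_kernel A alpha x) mf).
- exact: measurable_cst.
- by apply: (ae_imply _ _ _ f0) => y fy _; rewrite fy mulr0.
Qed.

(** The admissible levels are only required to be at least [t + e] for every [e > 0],
    because the infimum over levels absorbs [e]. *)
Lemma local_sharp_max_le (s : R) (Q0 : set Rn) (g : Rn -> R) (x : Rn) (b : \bar R) :
  (forall Q, subcubes_at Q0 x Q -> exists (c : R), exists2 t : R, (t%:E <= b)%E &
    0 <= t /\ forall e, 0 < e ->
    (leb (Q `&` [set y | (t + e < `|g y - c|)%R]) < s%:E * leb Q)%E) ->
  (local_sharp_max s Q0 g x <= b)%E.
Proof.
move=> h; apply: ge_ereal_sup => _ [Q QQ <-].
have [c [t tb [t0 ht]]] := h Q QQ.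
apply: le_trans tb; apply/lee_addgt0Pr => e e0; rewrite -EFinD.
apply: (@le_trans _ _ (ereal_inf [set r%:E | r in [set r : R | 0 <= r /\
  (leb (Q `&` [set y | (r < `|g y - c|)%R]) < s%:E * leb Q)%E]])).
  by apply: ereal_inf_lbound; exists c.
apply: ereal_inf_lbound; exists (t + e) => //; split; last exact: ht.
by rewrite addr_ge0// ltW.
Qed.

End Assembly.

Theorem theorem4p4 (R : realType) (n m : nat) (n_gt0 : (0 < n)%N)
  (s : R) (s_gt0 : 0 < s) (s_le : s <= 2^-1)
  (A : 'I_m -> 'M[R]_n)
  (A_unit : forall i, A i \in unitmx)
  (AB_unit : forall k k', k != k' -> A k - A k' \in unitmx)
  (alpha : 'I_m -> R)
  (alpha_gt0 : forall i, 0 < alpha i)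
  (alpha_sum : \sum_(i < m) alpha i = n%:R) :
  exists c : R, 0 < c /\
    forall f : lebesgue_cV_type R n -> R,
      measurable_fun [set: lebesgue_cV_type R n] f ->
      (* Tf(x) converges absolutely for almost every x *)
      {ae lebesgue_cV R n, forall x,
        (lebesgue_cV R n).-integrable [set: lebesgue_cV_type R n]
          (fun y => (frac_kernel A alpha x y * f y)%:E)} ->
      forall (Q0 : set (lebesgue_cV_type R n)) (x : lebesgue_cV_type R n),
        is_cube Q0 -> Q0 x ->
        (local_sharp_max s Q0 (frac_int A alpha f) x <=
          c%:E * \sum_(i < m)
            ereal_sup [set ereal_inf [set HL_max f (invmx (A i) *m y) | y in Q]
                      | Q in subcubes_at Q0 x])%E.
Proof.
have [C [C_ge1 A_le invA_le AB_ge]] := matrices_bound m A A_unit AB_unit.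
have C_gt0 : 0 < C by exact: lt_le_trans C_ge1.
have alpha_ge0 i : 0 <= alpha i by exact: ltW.
(* An exponent at least [n] leaves no room for a second one, so this alternative is
   the critical case of a single matrix. *)
have [alpha_lt|/existsNP[k /negP]] := pselect (forall k, alpha k < n%:R); last first.
  rewrite -leNgt => kn.
  have only j : j = k.
    apply/eqP; apply/negPn/negP => jk; move: alpha_sum.
    rewrite (bigD1 k)//= (bigD1 j)//= => h.
    have : 0 <= \sum_(i < m | (i != k) && (i != j)) alpha i by exact: sumr_ge0.
    by move: h (alpha_gt0 j) kn; lra.
  have D1 (F : 'I_m -> R) : (\prod_i F i = F k) * (\sum_i F i = F k).
    rewrite (bigD1 k)//= [X in _ * X]big1 ?mulr1; last first.
      by move=> i; rewrite (only i) eqxx.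
    rewrite (bigD1 k)//= [X in _ + X]big1 ?addr0//.
    by move=> i; rewrite (only i) eqxx.
  exists 1; split=> // f mf intf Q0 x _ _.
  have f0 : {ae lebesgue_cV R n, forall y, f y = 0}.
    apply: (ae_eq0_of_critical_integrable n_gt0 (A k) C C_gt0 (A_unit k)
      (A_le k) (invA_le k) f mf).
    apply: (ae_imply _ _ _ intf) => z; congr (integrable _ _ _).
    apply/funext => y; rewrite /frac_kernel D1.
    by rewrite -alpha_sum D1.
  apply: local_sharp_max_le => Q QQ; have [[a [l [l0 Qal]]] _ _] := QQ; exists 0, 0.
    rewrite mul1e; apply: sume_ge0 => i _.
    apply: le_trans (ereal_inf_HL_max_ge0 f (invmx (A i)) Q) _.
    by apply: ereal_sup_ubound; exists Q.
  split=> // e e0; rewrite (_ : _ `&` _ = set0).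
    by rewrite measure0 Qal lebesgue_cV_cube// -EFinM lte_fin mulr_gt0// exprn_gt0.
  rewrite -subset0 => y [_ /=].
  by rewrite frac_int_ae_eq0// subrr normr0 add0r ltNge ltW.
have [cW cW_gt0 W_bounded] :=
  integral_single_kernel_operator_le A alpha C alpha_gt0 alpha_lt.
pose c0 := @oscillation_constant R n C s cW.
have c0_gt0 : 0 < c0 by exact: oscillation_constant_gt0.
exists c0; split=> // f mf intf Q0 x _ _.
set b := (_ * \sum_(i < m) _)%E.
have [->|b_fin] := eqVneq b +oo%E; first exact: leey.
apply: local_sharp_max_le => Q QQ; have [[a [l [l0 Qal]]] _ _] := QQ.
pose J i := ereal_inf [set HL_max f (invmx (A i) *m w) | w in Q].
have J0 i : (0 <= J i)%E by exact: ereal_inf_HL_max_ge0.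
have Jb : (c0%:E * \sum_(i < m) J i <= b)%E.
  apply: lee_wpmul2l; first by rewrite lee_fin ltW.
  by apply: lee_sum => i _; apply: ereal_sup_ubound; exists Q.
(* If one of the infima over [Q] is infinite, so is the right-hand side. *)
have Jfin i : J i \is a fin_num.
  rewrite ge0_fin_numE// ltey; apply: contra b_fin => /eqP Ji.
  move: Jb; rewrite (bigD1 i)//= Ji addye; last first.
    by rewrite gt_eqF// (lt_le_trans (ltNyr 0))// sume_ge0.
  by rewrite gt0_muley ?lte_fin// leye_eq.
pose I i := fine (J i).
have IE i : J i = (I i)%:E by rewrite fineK.
have I0 i : 0 <= I i by rewrite -lee_fin -IE.
exists (\int[lebesgue_cV R n]_y far_a A alpha f a l y), (c0 * \sum_(i < m) I i).
  apply: le_trans Jb; rewrite EFinM -sumEFin.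
  by under [X in (_ <= _ * X)%E]eq_bigr do rewrite IE.
split; first by rewrite mulr_ge0 ?sumr_ge0// ltW.
move=> e e0; rewrite Qal.
apply: frac_int_oscillation_lt => //.
by move=> i; rewrite -Qal; exact: IE.
Qed.
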